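(* Let $q$ be an even prime power and let $P$ be a point of $\mathrm{PG}(5,q)$. The hyperplane-orbit distribution $OD_4(P)=[h_1,h_{2,r},h_{2,i},h_3]$ is: - $\left[q+1,\; q^3+\frac{3q^2+q}{2},\; \frac{q^2-q}{2},\; q^4-q^2\right]$ if $P\in\mathcal P_1$; - $\left[q^2+q+1,\; \frac{q^3+2q^2+q}{2},\; \frac{q^3-q}{2},\; q^4-q^2\right]$ if $P\in\mathcal P_{2,n}$; - $\left[q+1,\; \frac{q^3+3q^2+q}{2},\; \frac{q^3+q^2-q}{2},\; q^4-q^2\right]$ if $P\in\mathcal P_{2,s}$; - $\left[q+1,\; \frac{q^3+2q^2+q}{2},\; \frac{q^3-q}{2},\; q^4\right]$ if $P\in\mathcal P_3$.
   Context: A point $P=(y_0,\dots,y_5)$ of $\mathrm{PG}(5,q)$ is identified with the nonzero symmetric matrix $M_P=\begin{bmatrix} y_0&y_1&y_2\\ y_1&y_3&y_4\\ y_2&y_4&y_5\end{bmatrix}$ up to scalar; the rank of $P$ is the rank of $M_P$. The group $K\cong\mathrm{PGL}(3,q)$ acts by $M_P\mapsto AM_PA^T$, $A\in\mathrm{GL}(3,q)$. Point orbits ($q$ even): $\mathcal P_1$ = rank-1 points (the points of the Veronese surface $\mathcal V(\mathbb F_q)$); $\mathcal P_{2,n}$ = rank-2 points in the nucleus plane $Y_0=Y_3=Y_5=0$ (zero diagonal); $\mathcal P_{2,s}$ = rank-2 points not in the nucleus plane; $\mathcal P_3$ = rank-3 points. Hyperplanes of $\mathrm{PG}(5,q)$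 correspond to conics of $\mathrm{PG}(2,q)$ (nonzero quadratic forms up to scalar): the form $\sum_{0\le i\le j\le 2}a_{ij}X_iX_j$ corresponds to the hyperplane $a_{00}Y_0+a_{01}Y_1+a_{02}Y_2+a_{11}Y_3+a_{12}Y_4+a_{22}Y_5=0$. $\mathcal H_1,\mathcal H_{2,r},\mathcal H_{2,i},\mathcal H_3$ denote the sets of hyperplanes corresponding respectively to double lines (scalar multiples of squares of linear forms), pairs of distinct real lines (products of two non-proportional linear forms over $\mathbb F_q$), pairs of conjugate imaginary lines (scalar multiples of products of two non-proportional linear forms conjugate over $\mathbb F_{q^2}$), and non-singular conics (those with $4a_{00}a_{11}a_{22}+a_{01}a_{02}a_{12}-a_{00}a_{12}^2-a_{11}a_{02}^2-a_{22}a_{01}^2\ne0$). For a subspace $W$, $OD_4(W)=[h_1,h_{2,r},h_{2,i},h_3]$, where $h_1$ (resp. $h_{2,r},h_{2,i},h_3$) is the number of hyperplanes in $\mathcal H_1$ (resp. $\mathcal H_{2,r},\mathcal H_{2,i},\mathcal H_3$) containing $W$. *)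

(* Defs.v *)
From HB Require Import structures.
From mathcomp Require Import all_boot all_order all_algebra.
From mathcomp Require Import mpoly.

Set Implicit Arguments.
Unset Strict Implicit.
Unset Printing Implicit Defensive.

Import GRing.Theory.

Local Open Scope ring_scope.

(* A subspace of PG(5,q) is a subspace of the space 'rV[F]_6 of row vectors;
   points are those of vector-space dimension 1. *)

Definition coor (F : finFieldType) n (y : 'rV[F]_n.+1) (k : nat) : F :=
  y 0 (inord k).

Definition symmx (F : finFieldType) (y : 'rV[F]_6) : 'M[F]_3 :=
  \matrix_(i, j)
    nth 0 (nth [::] [:: [:: coor y 0; coor y 1; coor y 2];
                        [:: coor y 1; coor y 3; coor y 4];
                        [:: coor y 2; coor y 4; coor y 5]] i) j.

Definition is_point (F : finFieldType) (P : {vspace 'rV[F]_6}) : bool :=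
  \dim P == 1%N.

(* [vpick P] is a nonzero vector of P; for a point P the rank does not depend
   on which one is taken. *)
Definition point_rank (F : finFieldType) (P : {vspace 'rV[F]_6}) : nat :=
  \rank (symmx (vpick P)).

Definition nucleus_plane (F : finFieldType) : {set 'rV[F]_6} :=
  [set y : 'rV[F]_6 | [&& coor y 0 == 0, coor y 3 == 0 & coor y 5 == 0]].

Definition orbit_P1 (F : finFieldType) (P : {vspace 'rV[F]_6}) : bool :=
  is_point P && (point_rank P == 1%N).

Definition orbit_P2n (F : finFieldType) (P : {vspace 'rV[F]_6}) : bool :=
  [&& is_point P, point_rank P == 2%N & P \subset nucleus_plane F].

Definition orbit_P2s (F : finFieldType) (P : {vspace 'rV[F]_6}) : bool :=
  [&& is_point P, point_rank P == 2%N & ~~ (P \subset nucleus_plane F)].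

Definition orbit_P3 (F : finFieldType) (P : {vspace 'rV[F]_6}) : bool :=
  is_point P && (point_rank P == 3%N).

(* Linear and quadratic forms in X_0, X_1, X_2; the coefficients of a quadratic
   form are listed in the order a00, a01, a02, a11, a12, a22. *)

Definition lform (F : finFieldType) (b : 'rV[F]_3) : {mpoly F[3]} :=
  \sum_(i < 3) b 0 i *: 'X_i.

Definition var (F : finFieldType) (k : nat) : {mpoly F[3]} := 'X_(inord k).

Definition qform (F : finFieldType) (a : 'rV[F]_6) : {mpoly F[3]} :=
  let X := var F in
  coor a 0 *: X 0%N ^+ 2 + coor a 1 *: (X 0%N * X 1%N)
  + coor a 2 *: (X 0%N * X 2%N) + coor a 3 *: X 1%N ^+ 2
  + coor a 4 *: (X 1%N * X 2%N) + coor a 5 *: X 2%N ^+ 2.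

Definition proportional (F : finFieldType) (b c : 'rV[F]_3) : bool :=
  [exists k : F, (k != 0) && (b == k *: c)].

Definition double_line (F : finFieldType) (a : 'rV[F]_6) : bool :=
  [exists t : F, [exists b : 'rV[F]_3, qform a == t *: lform b ^+ 2]].

Definition real_line_pair (F : finFieldType) (a : 'rV[F]_6) : bool :=
  [exists b : 'rV[F]_3, [exists c : 'rV[F]_3,
    ~~ proportional b c && (qform a == lform b * lform c)]].

(* Here L stands for the field with #|F| ^ 2 elements, so that x |-> x ^+ #|F|
   is the conjugation of L over F. *)
Definition conj_row (F L : finFieldType) (b : 'rV[L]_3) : 'rV[L]_3 :=
  map_mx (fun x => x ^+ #|F|) b.

Definition imaginary_line_pair (F L : finFieldType) (iota : {rmorphism F -> L})
    (a : 'rV[F]_6) : bool :=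
  [exists t : F, [exists b : 'rV[L]_3,
    ~~ proportional b (conj_row F b) &&
    (map_mpoly iota (qform a) == iota t *: (lform b * lform (conj_row F b)))]].

Definition nonsingular (F : finFieldType) (a : 'rV[F]_6) : bool :=
  let a00 := coor a 0 in let a01 := coor a 1 in let a02 := coor a 2 in
  let a11 := coor a 3 in let a12 := coor a 4 in let a22 := coor a 5 in
  4%:R * a00 * a11 * a22 + a01 * a02 * a12
    - a00 * a12 ^+ 2 - a11 * a02 ^+ 2 - a22 * a01 ^+ 2 != 0.

(* A hyperplane is the set of its vectors, so that proportional coefficient
   vectors give the same hyperplane. *)
Definition hyperplane (F : finFieldType) (a : 'rV[F]_6) : {set 'rV[F]_6} :=
  [set y : 'rV[F]_6 | \sum_(k < 6) a 0 k * y 0 k == 0].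

Definition hyperplanes_of (F : finFieldType) (C : pred 'rV[F]_6) :
    {set {set 'rV[F]_6}} :=
  [set hyperplane a | a : 'rV[F]_6 & (a != 0) && C a].

Definition nb_through (F : finFieldType) (W : {vspace 'rV[F]_6})
    (Hs : {set {set 'rV[F]_6}}) : nat :=
  #|[set H in Hs | W \subset H]|.

Definition OD4 (F L : finFieldType) (iota : {rmorphism F -> L})
    (W : {vspace 'rV[F]_6}) : seq nat :=
  [:: nb_through W (hyperplanes_of (@double_line F));
      nb_through W (hyperplanes_of (@real_line_pair F));
      nb_through W (hyperplanes_of (imaginary_line_pair iota));
      nb_through W (hyperplanes_of (@nonsingular F))].

(* Main.v *)
Require Import Defs.
From HB Require Import structures.
From mathcomp Require Import all_boot all_order all_algebra all_field.
From mathcomp Require Import mpoly ring.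

Set Implicit Arguments.
Unset Strict Implicit.
Unset Printing Implicit Defensive.

Import GRing.Theory.

Local Open Scope ring_scope.

(* Write a form as [(n, d)], where [n = (a12, a02, a01)] is its nucleus and
   [d = (a00, a11, a22)]. In characteristic 2 its discriminant is its value at
   [n]. It is a double line when [n = 0]; otherwise it is nonsingular when it
   does not vanish at [n], and when it does, it descends to a binary form on the
   lines through [n], which splits over the quadratic extension
   (Artin-Schreier).
   Let [M] be the symmetric matrix of the point and [s] the vector of the square
   roots of its diagonal. For a fixed [n] the nonsingular forms through the point
   are counted by two linear conditions on [d], which are dependent only when [n]
   is a multiple of [s]; there, compatibility amounts to [\det M = 0], as
   [\det M] is a square. Real line pairs come from pairs [(b, c)] of independent
   linear forms with [b M c^T = 0], each being obtained [2 (q - 1)] times; here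
   [b M b^T = (b s^T) ^+ 2]. The conjugate line pairs are what remains. *)

(** * Coordinates and products of linear forms *)

Definition row6 (R : finFieldType) (s : seq R) : 'rV[R]_6 := \row_k s`_k.

Lemma coor_row6 (R : finFieldType) (s : seq R) k : (k < 6)%N ->
  coor (row6 s) k = s`_k.
Proof. by move=> lt_k6; rewrite /coor mxE inordK. Qed.

Lemma coorP (R : finFieldType) n (a b : 'rV[R]_n.+1) :
  (forall k, (k < n.+1)%N -> coor a k = coor b k) -> a = b.
Proof.
move=> eq_ab; apply/rowP=> k.
by have := eq_ab k (ltn_ord k); rewrite /coor inord_val.
Qed.

Lemma coorP3 (R : finFieldType) (a b : 'rV[R]_3) :
  coor a 0 = coor b 0 -> coor a 1 = coor b 1 -> coor a 2 = coor b 2 -> a = b.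
Proof. by move=> *; apply: coorP; case=> [|[|[|]]]. Qed.

Lemma coorP6 (R : finFieldType) (a b : 'rV[R]_6) :
    coor a 0 = coor b 0 -> coor a 1 = coor b 1 -> coor a 2 = coor b 2 ->
    coor a 3 = coor b 3 -> coor a 4 = coor b 4 -> coor a 5 = coor b 5 ->
  a = b.
Proof. by move=> *; apply: coorP; case=> [|[|[|[|[|[|]]]]]]. Qed.

Lemma coor0 (R : finFieldType) n i : coor (0 : 'rV[R]_n.+1) i = 0.
Proof. by rewrite /coor mxE. Qed.

Definition row3 (F : finFieldType) (x0 x1 x2 : F) : 'rV[F]_3 :=
  \row_k nth 0 [:: x0; x1; x2] k.

Lemma coor_row3 (F : finFieldType) (x0 x1 x2 : F) :
  (coor (row3 x0 x1 x2) 0 = x0) * (coor (row3 x0 x1 x2) 1 = x1)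
  * (coor (row3 x0 x1 x2) 2 = x2).
Proof. by rewrite /coor !mxE !inordK. Qed.

Lemma row3_eq0 (F : finFieldType) (x0 x1 x2 : F) :
  (row3 x0 x1 x2 == 0) = [&& x0 == 0, x1 == 0 & x2 == 0].
Proof.
apply/eqP/and3P => [e|[/eqP-> /eqP-> /eqP->]].
  have e' k : coor (row3 x0 x1 x2) k = 0 by rewrite e coor0.
  by have := (e' 0, e' 1, e' 2)%N; rewrite !coor_row3 => -[[-> ->] ->].
by apply: coorP3; rewrite coor_row3 coor0.
Qed.

Lemma coor_neq0 (R : finFieldType) n (a : 'rV[R]_n.+1) :
  a != 0 -> exists2 i, (i < n.+1)%N & coor a i != 0.
Proof. by case/rV0Pn=> i ai; exists i; rewrite ?ltn_ord /coor ?inord_val. Qed.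

Lemma coorZ (R : finFieldType) n (k : R) (a : 'rV[R]_n.+1) i :
  coor (k *: a) i = k * coor a i.
Proof. by rewrite /coor mxE. Qed.

Lemma coorD (R : finFieldType) n (a b : 'rV[R]_n.+1) i :
  coor (a + b) i = coor a i + coor b i.
Proof. by rewrite /coor mxE. Qed.

Lemma coor_map (R S : finFieldType) (f : R -> S) n (a : 'rV[R]_n.+1) i :
  coor (map_mx f a) i = f (coor a i).
Proof. by rewrite /coor mxE. Qed.

Lemma sum_coor3 (V : nmodType) (G : 'I_3 -> V) :
  \sum_k G k = G (inord 0) + G (inord 1) + G (inord 2).
Proof.
rewrite !big_ord_recl big_ord0 addr0 addrA.
by do ![congr (_ + _)]; congr G; apply: val_inj; rewrite /= inordK.
Qed.

Lemma sum_coor6 (V : nmodType) (G : 'I_6 -> V) :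
  \sum_k G k = G (inord 0) + G (inord 1) + G (inord 2)
    + G (inord 3) + G (inord 4) + G (inord 5).
Proof.
rewrite !big_ord_recl big_ord0 addr0 !addrA.
by do ![congr (_ + _)]; congr G; apply: val_inj; rewrite /= inordK.
Qed.

Definition dot (R : finFieldType) n (a y : 'rV[R]_n) : R :=
  \sum_k a 0 k * y 0 k.

Lemma dot3E (R : finFieldType) (a y : 'rV[R]_3) :
  dot a y = coor a 0 * coor y 0 + coor a 1 * coor y 1 + coor a 2 * coor y 2.
Proof. exact: sum_coor3. Qed.

Lemma dot6E (R : finFieldType) (a y : 'rV[R]_6) :
  dot a y = coor a 0 * coor y 0 + coor a 1 * coor y 1 + coor a 2 * coor y 2
    + coor a 3 * coor y 3 + coor a 4 * coor y 4 + coor a 5 * coor y 5.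
Proof. exact: sum_coor6. Qed.

Definition lprod (R : finFieldType) (b c : 'rV[R]_3) : 'rV[R]_6 :=
  row6 [:: coor b 0 * coor c 0; coor b 0 * coor c 1 + coor b 1 * coor c 0;
           coor b 0 * coor c 2 + coor b 2 * coor c 0; coor b 1 * coor c 1;
           coor b 1 * coor c 2 + coor b 2 * coor c 1; coor b 2 * coor c 2].

Lemma coor_lprod (R : finFieldType) (b c : 'rV[R]_3) :
  (coor (lprod b c) 0 = coor b 0 * coor c 0) *
  (coor (lprod b c) 1 = coor b 0 * coor c 1 + coor b 1 * coor c 0) *
  (coor (lprod b c) 2 = coor b 0 * coor c 2 + coor b 2 * coor c 0) *
  (coor (lprod b c) 3 = coor b 1 * coor c 1) *
  (coor (lprod b c) 4 = coor b 1 * coor c 2 + coor b 2 * coor c 1) *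
  (coor (lprod b c) 5 = coor b 2 * coor c 2).
Proof. by rewrite !coor_row6. Qed.

Lemma lformM (R : finFieldType) (b c : 'rV[R]_3) :
  lform b * lform c = qform (lprod b c).
Proof.
rewrite /lform !sum_coor3 /qform !coor_lprod -!/(coor _ _) -!/(var _ _) -!mul_mpolyC.
by rewrite !mpolyCD !mpolyCM; ring.
Qed.

Lemma qformZ (R : finFieldType) (t : R) (a : 'rV[R]_6) :
  t *: qform a = qform (t *: a).
Proof. by rewrite /qform !coorZ !scalerDr !scalerA. Qed.

Definition qval (R : finFieldType) (a : 'rV[R]_6) (x0 x1 x2 : R) : R :=
  coor a 0 * x0 ^+ 2 + coor a 1 * (x0 * x1) + coor a 2 * (x0 * x2)
  + coor a 3 * x1 ^+ 2 + coor a 4 * (x1 * x2) + coor a 5 * x2 ^+ 2.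

Lemma meval_qform (R : finFieldType) (a : 'rV[R]_6) (v : 'I_3 -> R) :
  (qform a).@[v] = qval a (v (inord 0)) (v (inord 1)) (v (inord 2)).
Proof.
by rewrite /qform !mevalD !mevalZ !(mevalM, rmorphXn) /= !mevalXU.
Qed.

(** The unit vectors give the coefficients of the squares, and the sums of two of them then give the
    mixed ones. Only the scalars 0 and 1 are used, so the argument holds even over the field with
    two elements. *)
Lemma qval_inj (R : finFieldType) (a b : 'rV[R]_6) :
  (forall x0 x1 x2, qval a x0 x1 x2 = qval b x0 x1 x2) -> a = b.
Proof.
move=> eqv; pose simp := (expr1n, expr0n, mulr0, mul0r, mulr1, addr0, add0r).
have e0 : coor a 0 = coor b 0 by have := eqv 1 0 0; rewrite /qval !simp.
have e3 : coor a 3 = coor b 3 by have := eqv 0 1 0; rewrite /qval !simp.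
have e5 : coor a 5 = coor b 5 by have := eqv 0 0 1; rewrite /qval !simp.
apply: coorP6 => //.
- by have := eqv 1 1 0; rewrite /qval !simp e0 e3 => /addIr/addrI.
- by have := eqv 1 0 1; rewrite /qval !simp e0 e5 => /addIr/addrI.
- by have := eqv 0 1 1; rewrite /qval !simp e3 e5 => /addIr/addrI.
Qed.

Lemma qform_inj (R : finFieldType) : injective (@qform R).
Proof.
move=> a b eq_ab; apply: qval_inj => x0 x1 x2.
pose v (k : 'I_3) := nth 0 [:: x0; x1; x2] k.
by have := congr1 (meval v) eq_ab; rewrite !meval_qform /v !inordK.
Qed.

Lemma map_qform (F L : finFieldType) (iota : {rmorphism F -> L})
  (a : 'rV[F]_6) : map_mpoly iota (qform a) = qform (map_mx iota a).
Proof.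
rewrite /qform !rmorphD /= !map_mpolyZ !coor_map.
by rewrite !(rmorphM, rmorphXn) /= /var !map_mpolyX.
Qed.

(** Reduces an identity of characteristic 2 to one that [ring] can check: the witness [e] is half of
    the difference of the two sides, computed with integer coefficients. *)
Lemma char2_eq (R : finFieldType) (e x y : R) :
  2%:R = 0 :> R -> x = y + 2%:R * e -> x = y.
Proof. by move=> -> ->; rewrite mul0r addr0. Qed.

Definition polar0 (R : finFieldType) (a : 'rV[R]_6) : bool :=
  [&& coor a 1 == 0, coor a 2 == 0 & coor a 4 == 0].

Definition nval (R : finFieldType) (a : 'rV[R]_6) : R :=
  qval a (coor a 4) (coor a 2) (coor a 1).

Lemma nonsingularE (R : finFieldType) (a : 'rV[R]_6) : 2%:R = 0 :> R ->
  nonsingular a = (nval a != 0).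
Proof.
move=> h2; congr (_ != 0); rewrite /nval /qval.
(* At the nucleus each mixed monomial equals [a01 * a02 * a12], which thus occurs three times; the
   difference from the discriminant is even. *)
apply: (char2_eq (e := 2%:R * coor a 0 * coor a 3 * coor a 5
  - coor a 1 * coor a 2 * coor a 4 - coor a 0 * coor a 4 ^+ 2
  - coor a 3 * coor a 2 ^+ 2 - coor a 5 * coor a 1 ^+ 2)) => //.
by ring.
Qed.

Lemma polar0_nval (R : finFieldType) (a : 'rV[R]_6) :
  polar0 a -> nval a = 0.
Proof.
by case/and3P=> /eqP e1 /eqP e2 /eqP e4; rewrite /nval /qval e1 e2 e4; ring.
Qed.

Lemma lprod_sym (R : finFieldType) (b c : 'rV[R]_3) : lprod b c = lprod c b.
Proof. by apply: qform_inj; rewrite -!lformM mulrC. Qed.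

Lemma lprodZl (R : finFieldType) k (b c : 'rV[R]_3) :
  lprod (k *: b) c = k *: lprod b c.
Proof. by apply: coorP6; rewrite !(coorZ, coor_lprod); ring. Qed.

Lemma lprodZr (R : finFieldType) k (b c : 'rV[R]_3) :
  lprod b (k *: c) = k *: lprod b c.
Proof. by rewrite lprod_sym lprodZl lprod_sym. Qed.

Lemma lprodDl (R : finFieldType) (b b' c : 'rV[R]_3) :
  lprod (b + b') c = lprod b c + lprod b' c.
Proof. by apply: coorP6; rewrite !(coorD, coor_lprod); ring. Qed.

Lemma lprodDr (R : finFieldType) (b c c' : 'rV[R]_3) :
  lprod b (c + c') = lprod b c + lprod b c'.
Proof. by rewrite lprod_sym lprodDl !(lprod_sym b). Qed.

Lemma polar0Z (R : finFieldType) k (a : 'rV[R]_6) :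
  k != 0 -> polar0 (k *: a) = polar0 a.
Proof. by move=> k0; rewrite /polar0 !coorZ !mulf_eq0 (negPf k0). Qed.

Lemma nvalZ (R : finFieldType) k (a : 'rV[R]_6) :
  nval (k *: a) = k ^+ 3 * nval a.
Proof. by rewrite /nval /qval !coorZ; ring. Qed.

Lemma polar0_map (F L : finFieldType) (iota : {rmorphism F -> L})
  (a : 'rV[F]_6) : polar0 (map_mx iota a) = polar0 a.
Proof. by rewrite /polar0 !coor_map !fmorph_eq0. Qed.

Lemma nval_map (F L : finFieldType) (iota : {rmorphism F -> L})
  (a : 'rV[F]_6) : nval (map_mx iota a) = iota (nval a).
Proof.
by rewrite /nval /qval !coor_map !(rmorphD, rmorphM, rmorphXn).
Qed.

Lemma proportional_polar0 (R : finFieldType) (b c : 'rV[R]_3) :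
  2%:R = 0 :> R -> proportional b c -> polar0 (lprod b c).
Proof.
move=> h2 /existsP[k /andP[_ /eqP->]]; rewrite /polar0 !coor_lprod !coorZ.
have addrr2 (x : R) : x + x = 0 by rewrite -mulr2n -mulr_natl h2 mul0r.
by apply/and3P; split; rewrite mulrAC -mulrA addrC mulrCA mulrA addrr2.
Qed.

(** Up to signs, which disappear in characteristic 2, the nucleus of a product is the vector product
    of the two lines, that is, their common point when they are distinct; both factors vanish
    there. *)
Lemma nval_lprod (R : finFieldType) (b c : 'rV[R]_3) :
  2%:R = 0 :> R -> nval (lprod b c) = 0.
Proof.
move=> h2; rewrite /nval /qval !coor_lprod.
apply: (char2_eq (e := (coor b 0 * coor b 1 * coor c 2
    + coor b 0 * coor b 2 * coor c 1 + coor b 1 * coor b 2 * coor c 0)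
  * (2%:R * (coor b 0 * coor c 1 * coor c 2
    + coor b 1 * coor c 0 * coor c 2 + coor b 2 * coor c 0 * coor c 1)))) => //.
by ring.
Qed.

Lemma lprod0 (R : finFieldType) (c : 'rV[R]_3) : lprod 0 c = 0.
Proof. by rewrite -(scale0r 0) lprodZl scale0r. Qed.

Definition cross (R : finFieldType) (b c : 'rV[R]_3) : 'rV[R]_3 :=
  row3 (coor b 1 * coor c 2 - coor b 2 * coor c 1)
       (coor b 2 * coor c 0 - coor b 0 * coor c 2)
       (coor b 0 * coor c 1 - coor b 1 * coor c 0).

Lemma coor_cross (R : finFieldType) (b c : 'rV[R]_3) :
  (coor (cross b c) 0 = coor b 1 * coor c 2 - coor b 2 * coor c 1) *
  (coor (cross b c) 1 = coor b 2 * coor c 0 - coor b 0 * coor c 2) *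
  (coor (cross b c) 2 = coor b 0 * coor c 1 - coor b 1 * coor c 0).
Proof. by rewrite !coor_row3. Qed.

Lemma cross_proportional (R : finFieldType) (b c : 'rV[R]_3) :
  b != 0 -> c != 0 -> cross b c = 0 -> proportional b c.
Proof.
move=> b0 c0 /(congr1 (coor (n := 2)))eq_bc.
have e0 := congr1 (fun f => f 0) eq_bc.
have e1 := congr1 (fun f => f 1) eq_bc.
have e2 := congr1 (fun f => f 2) eq_bc.
rewrite !coor_cross !coor0 in e0 e1 e2.
move/eqP: e0; rewrite subr_eq0 => /eqP e0.
move/eqP: e1; rewrite subr_eq0 => /eqP e1.
move/eqP: e2; rewrite subr_eq0 => /eqP e2.
have [i lt_i3 ci] := coor_neq0 c0.
suff eq_b : b = (coor b i / coor c i) *: c.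
  apply/existsP; exists (coor b i / coor c i); rewrite -eq_b eqxx andbT.
  by apply: contraNneq b0 => k0; rewrite eq_b k0 scale0r.
by apply: coorP3; rewrite coorZ mulrAC;
  case: i lt_i3 ci => [|[|[|//]]] _ ci; apply: canRL (mulfK ci) _.
Qed.

(** The mixed coefficients of the product are, up to sign, the coordinates of [cross b c], and signs
    do not matter here. *)
Lemma lprod_polar0 (R : finFieldType) (b c : 'rV[R]_3) : 2%:R = 0 :> R ->
  lprod b c != 0 -> polar0 (lprod b c) -> proportional b c.
Proof.
move=> h2 bc0 /and3P[]; rewrite !coor_lprod => /eqP e1 /eqP e2 /eqP e4.
apply: cross_proportional.
- by apply: contraNneq bc0 => ->; rewrite lprod0.
- by apply: contraNneq bc0 => ->; rewrite lprod_sym lprod0.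
have sub_add (x y : R) : x - y = x + y.
  by apply: (char2_eq (e := - y)) => //; ring.
apply: coorP3; rewrite coor_cross coor0 sub_add //.
by rewrite addrC.
Qed.

Lemma lprod_eq0 (R : finFieldType) (b c : 'rV[R]_3) :
  (lprod b c == 0) = (b == 0) || (c == 0).
Proof.
apply/idP/orP=> [|[]/eqP->]; last 2 first.
- by rewrite lprod0.
- by rewrite lprod_sym lprod0.
move=> /eqP bc0; case: (eqVneq b 0) => [_|b0]; [by left | right].
have [i lt_i3 bi] := coor_neq0 b0.
have e k : coor (lprod b c) k = 0 by rewrite bc0 coor0.
have [[[[[e0 e1] e2] e3] e4] e5] := (e 0, e 1, e 2, e 3, e 4, e 5)%N.
rewrite !coor_lprod in e0 e1 e2 e3 e4 e5.
(* With [coor b i] nonzero, the coefficient of the square of the variable of index [i] kills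
   [coor c i]; the mixed coefficients involving [i] then kill the other two coordinates. *)
have cancel_b (x : R) : coor b i * x = 0 -> x = 0.
  by move/eqP; rewrite mulf_eq0 (negPf bi) => /eqP.
apply/eqP.
by case: i lt_i3 {bi} cancel_b => [|[|[|//]]] _ cancel_b;
  [ have c0 := cancel_b _ e0 | have c0 := cancel_b _ e3
  | have c0 := cancel_b _ e5 ];
  rewrite ?c0 ?mulr0 ?addr0 ?add0r in e1 e2 e4;
  apply: coorP3; rewrite coor0 //; apply: cancel_b.
Qed.

Lemma qval_lprod (R : finFieldType) (b c x : 'rV[R]_3) :
  qval (lprod b c) (coor x 0) (coor x 1) (coor x 2) = dot b x * dot c x.
Proof. by rewrite /qval !coor_lprod !dot3E; ring. Qed.

(* On the line [b' = 0], parametrised by [p |-> cross b' p], the product of [b]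
   and [c] becomes that of [cross b b'] and [cross c b'], so one of these
   vanishes. *)
Lemma lprod_prime (R : finFieldType) (b c b' c' : 'rV[R]_3) :
  lprod b c != 0 -> lprod b c = lprod b' c' ->
  proportional b b' \/ proportional c b'.
Proof.
move=> bc0 eq_bc; have := bc0; rewrite lprod_eq0 => /norP[b0 c0].
have := bc0; rewrite eq_bc lprod_eq0 => /norP[b'0 _].
have : lprod (cross b b') (cross c b') == 0.
  apply/eqP/qval_inj=> x0 x1 x2.
  pose p := row3 x0 x1 x2.
  have [p0 p1 p2] : [/\ x0 = coor p 0, x1 = coor p 1 & x2 = coor p 2].
    by rewrite !coor_row3.
  rewrite p0 p1 p2 qval_lprod.
  have crossE d : dot (cross d b') p = dot d (cross b' p).
    by rewrite !dot3E !coor_cross; ring.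
  rewrite !crossE -qval_lprod eq_bc qval_lprod.
  have -> : dot b' (cross b' p) = 0 by rewrite dot3E !coor_cross; ring.
  by rewrite mul0r /qval !coor0; ring.
by rewrite lprod_eq0 => /orP[]/eqP/cross_proportional H; [left | right]; apply: H.
Qed.

(** * Even characteristic and the quadratic extension *)

(** Serves three times: for [z ^+ 2 + z], which is two-to-one, for the passage from forms to
    hyperplanes, and for the products of ordered pairs of linear forms. *)
Lemma card_fibres (T U : finType) (f : T -> U) (A : {set T}) m :
    (forall x, x \in A -> #|[set z in A | f z == f x]| = m) ->
  #|A| = (#|f @: A| * m)%N.
Proof.
move=> fib; rewrite -sum1_card (partition_big_imset f) /= -sum_nat_const.
apply: eq_bigr => _ /imsetP[x Ax ->]; rewrite -(fib x Ax) -sum1_card.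
by apply: eq_bigl => z; rewrite inE.
Qed.

Lemma even_card_pchar2 (F : finFieldType) : ~~ odd #|F| -> 2%N \in [pchar F].
Proof.
move=> even_F; have [p pr_p charFp] := finPcharP F.
have := card_pprimeChar charFp; set n := logn _ _ => card_F.
rewrite card_F oddX negb_or in even_F; case/andP: even_F => _ odd_p.
by case: (even_prime pr_p) odd_p => [<- //|->].
Qed.

Lemma pchar2_card (F : finFieldType) :
  2%N \in [pchar F] -> #|F| = (2 ^ logn 2 #|F|)%N.
Proof. exact: card_pprimeChar. Qed.

Lemma pchar2_2 (F : finFieldType) : 2%N \in [pchar F] -> 2%:R = 0 :> F.
Proof. exact: pcharf0. Qed.

(** The order of [F] is a power of 2, and raising to half of it is inverse to squaring, since
    raising to the power [#|F|] is the identity. *)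
Lemma sqrt_pchar2 (F : finFieldType) (x : F) : 2%N \in [pchar F] ->
  exists z, z ^+ 2 = x.
Proof.
move=> char2; exists (x ^+ (2 ^ (logn 2 #|F|).-1)).
rewrite -exprM -expnSr prednK -?pchar2_card ?expf_card //.
have := finNzRing_gt1 F; rewrite {1}(pchar2_card char2).
by case: (logn _ _).
Qed.

Lemma sqr_inj_pchar2 (F : finFieldType) : 2%N \in [pchar F] ->
  injective (fun x : F => x ^+ 2).
Proof.
move=> char2 x y /= eq_xy; apply/eqP; rewrite -subr_eq0 -[_ == _]andTb -(expf_eq0 _ 2).
by apply/eqP/(char2_eq (e := y ^+ 2 - x * y) (pchar2_2 char2)); ring: eq_xy.
Qed.

Section QuadraticExtension.

Variables (F L : finFieldType) (iota : {rmorphism F -> L}).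
Hypotheses (char2 : 2%N \in [pchar F]) (cardL : #|L| = (#|F| ^ 2)%N).

Let q := #|F|.

Lemma pchar2_ext : 2%N \in [pchar L].
Proof. by rewrite (fmorph_pchar iota). Qed.

Lemma conjD (x y : L) : (x + y) ^+ q = x ^+ q + y ^+ q.
Proof.
apply: exprDn_pchar; rewrite /q (pchar2_card char2).
by rewrite pnatX pnatE // pchar2_ext.
Qed.

Lemma conjK (x : L) : (x ^+ q) ^+ q = x.
Proof. by rewrite -exprM mulnn -cardL expf_card. Qed.

Lemma conj_iota (x : F) : iota x ^+ q = iota x.
Proof. by rewrite -rmorphXn /= expf_card. Qed.

(** The polynomial [X ^ q - X] is the product of the [X - z] for [z] in [F], so a root of it in [L]
    is the image of some [z]. *)
Lemma conj_fixed (x : L) : x ^+ q = x -> exists z, x = iota z.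
Proof.
move=> fix_x; have := congr1 (fun p => (map_poly iota p).[x]) (finField_genPoly F).
rewrite rmorphB /= map_polyXn map_polyX !hornerE fix_x subrr.
rewrite rmorph_prod horner_prod => /esym/eqP/prodf_eq0[z _].
by rewrite rmorphB /= map_polyX map_polyC !hornerE subr_eq0 => /eqP; exists z.
Qed.

(* Some [d = w ^+ 2 + w] with [w] outside [F] represents the nonzero class of
   [F] modulo the index-2 subgroup of the values of [z ^+ 2 + z] on [F]. *)
Lemma artin_schreier_root (d : F) : exists w : L, w ^+ 2 + w = iota d.
Proof.
have hF2 := pchar2_2 char2; have hL2 := pchar2_2 pchar2_ext.
(* By cardinality some element of [L] is moved by the conjugation; dividing it by its trace, which
   is nonzero, makes the conjugation add 1. *)
have [w [fw nFw]] : exists w : L, w ^+ q = w + 1 /\ forall z, w != iota z.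
  have [w nFw] : exists w : L, w ^+ q != w.
    apply/existsP; apply: contraT => /existsPn/= fixL.
    have imF : #|iota @: [set: F]| = #|L|.
      apply: eq_card => x; rewrite [RHS]inE; apply/imsetP.
      by have [//|z ->] := @conj_fixed x; [exact/eqP/negPn | exists z].
    rewrite card_imset in imF; last exact: fmorph_inj.
    rewrite cardsT cardL in imF.
    by have := ltn_exp2l 1 2 (finNzRing_gt1 F); rewrite -imF expn1 ltnn.
  have [t tE] : exists t, w + w ^+ q = iota t.
    by apply: conj_fixed; rewrite conjD conjK addrC.
  have t0 : iota t != 0.
    apply: contraNneq nFw => t0; apply/eqP/(char2_eq (e := - w)) => //.
    by move/eqP: t0; rewrite -tE addrC addr_eq0 => /eqP->; ring.
  exists (w / iota t); split=> [|z].
    rewrite exprMn -fmorphV conj_iota fmorphV.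
    apply: (mulIf t0); rewrite mulrDl !divfK // mul1r -tE.
    by apply/esym/(char2_eq (e := w)) => //; ring.
  apply: contraNneq nFw => /(canRL (divfK t0)) ->.
  by rewrite -rmorphM conj_iota.
have [d0 d0E] : exists d0, w ^+ 2 + w = iota d0.
  apply: conj_fixed; rewrite conjD -exprM mulnC exprM fw.
  by apply: (char2_eq (e := w + 1)) => //; ring.
pose phi (z : F) := z ^+ 2 + z.
pose A := phi @: [set: F].
have cardA : #|F| = (#|A| * 2)%N.
  rewrite -cardsT; apply: card_fibres => x _.
  suff -> : [set z in [set: F] | phi z == phi x] = [set x; x + 1].
    by rewrite cards2 -{1}[x]addr0 (inj_eq (addrI x)) eq_sym oner_eq0.
  apply/setP=> z; rewrite !inE /= -subr_eq0 -(subr_eq0 z) -(subr_eq0 z (x + 1)).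
  rewrite -mulf_eq0; congr (_ == 0).
  by apply: (char2_eq (e := z + z * x - x ^+ 2 - x)) => //; rewrite /phi; ring.
pose B := (+%R d0) @: A.
have cardB : #|B| = #|A| by rewrite card_imset //; apply: addrI.
have disjAB : [disjoint A & B].
  apply/pred0P=> x /=; apply/negP => /andP[/imsetP[z _ ->]].
  case/imsetP=> _ /imsetP[z' _ ->] eq_phi.
  (* If the two cosets met, [w] would be a root of a quadratic polynomial whose roots [z + z'] and
     [z + z' + 1] lie in [F]. *)
  have : (w - iota (z + z')) * (w + iota (z + z') + 1) = 0.
    have := congr1 iota eq_phi; rewrite /phi !(rmorphD, rmorphXn) /= -d0E => e.
    have -> : (w - (iota z + iota z')) * (w + (iota z + iota z') + 1)
        = w ^+ 2 + w - (iota z ^+ 2 + iota z) - (iota z' ^+ 2 + iota z')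
          - 2%:R * (iota z * iota z') by ring.
    by rewrite e hL2; apply: (char2_eq (e := - iota z' ^+ 2 - iota z')) => //; ring.
  move/eqP; rewrite mulf_eq0 subr_eq0 (negPf (nFw _)) /= => /eqP.
  move/(canRL (addrK _)); rewrite add0r => /(canRL (addrK _)) wE.
  by have := nFw (-1 - (z + z')); rewrite wE rmorphB rmorphN rmorph1 eqxx.
have : d \in A :|: B.
  suff -> : A :|: B = [set: F] by rewrite inE.
  apply/eqP; rewrite eqEcard subsetT cardsT cardA cardsU.
  by rewrite (disjoint_setI0 disjAB) cards0 cardB subn0 muln2 addnn leqnn.
case/setUP=> [/imsetP[z _ ->]|/imsetP[_ /imsetP[z _ ->] ->]].
  by exists (iota z); rewrite !(rmorphD, rmorphXn).
exists (w + iota z); rewrite !(rmorphD, rmorphXn) /= -d0E.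
by apply: (char2_eq (e := w * iota z)) => //; ring.
Qed.

End QuadraticExtension.

(** * Classification of singular forms *)

(** Without mixed terms, the form is the square of the linear form whose coefficients are the square
    roots of its own. *)
Lemma double_lineE (F : finFieldType) (a : 'rV[F]_6) :
  2%N \in [pchar F] -> double_line a = polar0 a.
Proof.
move=> char2; apply/existsP/idP => [[t /existsP[b]]|/and3P[/eqP a1 /eqP a2 /eqP a4]].
  rewrite expr2 lformM qformZ => /eqP/qform_inj->.
  have [->|t0] := eqVneq t 0; first by rewrite scale0r /polar0 !coor0 eqxx.
  rewrite polar0Z //; apply: proportional_polar0; first exact: pchar2_2.
  by apply/existsP; exists 1; rewrite oner_eq0 scale1r eqxx.
have [[[s0 e0] [s1 e1]] [s2 e2]] := (sqrt_pchar2 (coor a 0) char2,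
  sqrt_pchar2 (coor a 3) char2, sqrt_pchar2 (coor a 5) char2).
exists 1; apply/existsP; exists (row3 s0 s1 s2).
rewrite expr2 lformM scale1r; apply/eqP; congr qform.
have h2 := pchar2_2 char2.
by apply: coorP6; rewrite !coor_lprod !coor_row3
  ?a1 ?a2 ?a4 -?e0 -?e1 -?e2 /= ?expr2 // mulrC -mulr2n -mulr_natl h2 mul0r.
Qed.

Lemma real_line_pairP (F : finFieldType) (a : 'rV[F]_6) :
  reflect (exists b c, ~~ proportional b c /\ a = lprod b c) (real_line_pair a).
Proof.
apply: (iffP existsP) => [[b /existsP[c /andP[nbc]]]|[b [c [nbc ->]]]].
  by rewrite lformM => /eqP/qform_inj->; exists b, c.
by exists b; apply/existsP; exists c; rewrite nbc lformM /=.
Qed.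

Lemma imaginary_line_pairP (F L : finFieldType) (iota : {rmorphism F -> L})
    (a : 'rV[F]_6) :
  reflect (exists t b, ~~ proportional b (conj_row F b) /\
             map_mx iota a = iota t *: lprod b (conj_row F b))
          (imaginary_line_pair iota a).
Proof.
apply: (iffP existsP) => [[t /existsP[b /andP[nb]]]|[t [b [nb ab]]]].
  by rewrite map_qform lformM qformZ => /eqP/qform_inj->; exists t, b.
by exists t; apply/existsP; exists b; rewrite nb map_qform lformM qformZ ab /=.
Qed.

Lemma proportional_sym (F : finFieldType) (b c : 'rV[F]_3) :
  proportional b c -> proportional c b.
Proof.
case/existsP=> k /andP[k0 /eqP->]; apply/existsP; exists k^-1.
by rewrite invr_eq0 k0 scalerA mulVf // scale1r eqxx.
Qed.

Lemma proportional_trans (F : finFieldType) (b c d : 'rV[F]_3) :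
  proportional b c -> proportional c d -> proportional b d.
Proof.
case/existsP=> k /andP[k0 /eqP->] /existsP[l /andP[l0 /eqP->]].
by apply/existsP; exists (k * l); rewrite mulf_neq0 //= scalerA eqxx.
Qed.

Lemma map_lprod (F L : finFieldType) (iota : {rmorphism F -> L})
    (b c : 'rV[F]_3) :
  map_mx iota (lprod b c) = lprod (map_mx iota b) (map_mx iota c).
Proof.
by apply: coorP6; rewrite !(coor_map, coor_lprod) ?rmorphD !rmorphM.
Qed.

Section Classification.

Variables (F L : finFieldType) (iota : {rmorphism F -> L}).
Hypotheses (char2 : 2%N \in [pchar F]) (cardL : #|L| = (#|F| ^ 2)%N).

Let q := #|F|.
Let h2 : 2%:R = 0 :> F := pchar2_2 char2.
Let hL2 : 2%:R = 0 :> L := pchar2_2 (pchar2_ext iota char2).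

Lemma real_line_pair_singular (a : 'rV[F]_6) : a != 0 ->
  real_line_pair a -> ~~ polar0 a && (nval a == 0).
Proof.
move=> a0 /real_line_pairP[b [c [nbc aE]]]; rewrite aE nval_lprod // eqxx andbT.
by apply: contra nbc; apply: lprod_polar0; rewrite -?aE.
Qed.

Lemma imaginary_line_pair_singular (a : 'rV[F]_6) : a != 0 ->
  imaginary_line_pair iota a -> ~~ polar0 a && (nval a == 0).
Proof.
rewrite -(map_mx_eq0 iota) => a0 /imaginary_line_pairP[t [b [nb aE]]].
rewrite -(polar0_map iota) -(fmorph_eq0 iota) -nval_map aE nvalZ nval_lprod //.
rewrite mulr0 eqxx andbT; rewrite aE scaler_eq0 in a0; case/norP: a0 => t0 b0.
by rewrite polar0Z //; apply: contra nb; apply: lprod_polar0.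
Qed.

(** Over [L], unique factorisation makes [d] proportional to a linear form defined over [F]. The
    latter is fixed by the conjugation, so [d] is proportional to its own conjugate, which is
    excluded. *)
Lemma real_imaginary_disjoint (a : 'rV[F]_6) : a != 0 ->
  real_line_pair a -> ~~ imaginary_line_pair iota a.
Proof.
rewrite -(map_mx_eq0 iota) => a0 /real_line_pairP[b [c [_ aE]]].
apply/imaginary_line_pairP=> -[t [d [/negP nd aE']]]; apply: nd.
have : proportional (map_mx iota b) d \/ proportional (map_mx iota c) d.
  apply: (lprod_prime (c' := iota t *: conj_row F d)); first by rewrite -map_lprod -aE.
  by rewrite lprodZr -aE' aE map_lprod.
suff main (e : 'rV[F]_3) : proportional (map_mx iota e) d ->
  proportional d (conj_row F d) by case=> /main.
case/proportional_sym/existsP=> k /andP[k0 /eqP->].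
apply: (@proportional_trans _ _ (map_mx iota e)).
  by apply/existsP; exists k; rewrite k0 eqxx.
apply: proportional_sym; apply/existsP; exists (k ^+ q).
rewrite expf_neq0 //=; apply/eqP/rowP=> i; rewrite !mxE exprMn.
by rewrite -rmorphXn expf_card.
Qed.

(** The substitution of [s * w] for [w] turns the equation into [w ^+ 2 + w = p / s ^+ 2]. *)
Lemma quadratic_root (s p : F) : s != 0 ->
  exists w : L, w ^+ 2 + iota s * w + iota p = 0.
Proof.
move=> s0; have [w wE] := artin_schreier_root iota char2 cardL (p / s ^+ 2).
exists (iota s * w).
have -> : (iota s * w) ^+ 2 + iota s * (iota s * w) + iota p =
  iota s ^+ 2 * (w ^+ 2 + w) + iota p by ring.
rewrite wE -rmorphXn -rmorphM -rmorphD /= mulrC divfK ?expf_neq0 //.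
by rewrite -mulr2n -mulr_natl h2 mul0r rmorph0.
Qed.

(** If [A = 0], then [v] is a factor. Otherwise divide by [A] and take a root [w] of
    [w ^+ 2 + s * w + p]: the factors are [u + w v] and [u + w' v], with [w'] the other root. They
    are real if [w] is in [F]; if not, [w'] is the conjugate of [w]. *)
Lemma binary_line_pair (a : 'rV[F]_6) (u v : 'rV[F]_3) (A B C : F) :
    a = A *: lprod u u + B *: lprod u v + C *: lprod v v ->
    ~~ polar0 a -> real_line_pair a || imaginary_line_pair iota a.
Proof.
move=> aE na.
have B0 : B != 0.
  apply: contraNneq na => B0; rewrite aE B0 scale0r addr0 /polar0.
  have polE x y z t : A * (x * y + y * x) + C * (z * t + t * z) = 0.
    by apply: (char2_eq (e := A * x * y + C * z * t)) => //; ring.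
  by rewrite !(coorD, coorZ, coor_lprod) !polE eqxx.
have real b c : a = lprod b c -> real_line_pair a.
  move=> aE'; apply/real_line_pairP; exists b, c; split=> //.
  by apply: contra na; rewrite aE'; apply: proportional_polar0.
have [A0|A0] := eqVneq A 0.
  rewrite (real v (B *: u + C *: v)) // aE A0 scale0r add0r lprodDr !lprodZr.
  by rewrite (lprod_sym v).
have [s BE] : exists s, B = A * s by exists (B / A); rewrite mulrC divfK.
have [p CE] : exists p, C = A * p by exists (C / A); rewrite mulrC divfK.
have [|w wE] := @quadratic_root s p.
  by apply: contraNneq B0 => s0; rewrite BE s0 mulr0.
have [fix_w|nfix_w] := eqVneq (w ^+ q) w.
  have [r rE] := conj_fixed iota fix_w.
  (* In characteristic 2 the roots have sum [s], so the second one is [r + s]. *)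
  have pE : p = r * (r + s).
    apply: (char2_eq (e := p)) => //.
    have : iota (r ^+ 2 + s * r + p) = 0.
      by rewrite !(rmorphD, rmorphM, rmorphXn) /= -rE.
    move/eqP; rewrite fmorph_eq0 => /eqP e.
    by rewrite -[LHS]add0r -e; ring.
  rewrite (real (A *: (u + r *: v)) (u + (r + s) *: v)) //.
  rewrite lprodZl lprodDl !lprodDr !(lprodZl, lprodZr) (lprod_sym v u) aE.
  apply: coorP => k _; rewrite !(coorD, coorZ) BE CE pE.
  by apply: (char2_eq (e := - (A * r * coor (lprod u v) k))) => //; ring.
apply/orP; right; apply/imaginary_line_pairP.
pose U := map_mx iota u; pose V := map_mx iota v.
have conjE : conj_row F (U + w *: V) = U + w ^+ q *: V.
  apply/rowP=> i; rewrite !mxE (conjD iota) ?exprMn //.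
  by rewrite !conj_iota.
have sumE : iota s = w + w ^+ q.
  have wqE : (w ^+ q) ^+ 2 + iota s * w ^+ q + iota p = 0.
    rewrite -(conj_iota iota s) -(conj_iota iota p) -exprMn -exprM mulnC exprM.
    by rewrite -!(conjD iota) // wE expr0n; case: (#|F|) (finNzRing_gt1 F).
  (* Both [w] and its conjugate are roots; subtracting the two equations and cancelling the nonzero
     difference gives their sum. *)
  have : (w ^+ q - w) * (w ^+ q + w + iota s) = 0.
    by rewrite -[RHS](subrr (0 : L)) -{1}wqE -wE; ring.
  move/eqP; rewrite mulf_eq0 subr_eq0 (negPf nfix_w) addr_eq0 /= => /eqP e.
  by apply: (char2_eq (e := iota s)) => //; rewrite [w + _]addrC e; ring.
have prodE : iota p = w * w ^+ q.
  apply: (char2_eq (e := iota p + w ^+ 2)) => //.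
  by rewrite -[LHS]add0r -{1}wE sumE; ring.
have aE' : map_mx iota a = iota A *: lprod (U + w *: V) (U + w ^+ q *: V).
  rewrite aE !map_mxD !map_mxZ !map_lprod -/U -/V BE CE !rmorphM /= sumE prodE.
  rewrite lprodDl !lprodDr !(lprodZl, lprodZr) (lprod_sym V U).
  by apply: coorP => k _; rewrite !(coorD, coorZ); ring.
exists A, (U + w *: V); rewrite conjE; split=> //.
apply: contra na => /(proportional_polar0 hL2); rewrite -(polar0_map iota) aE'.
by rewrite polar0Z // fmorph_eq0.
Qed.

(* If, say, the last coordinate of the nucleus is nonzero, substituting
   [X0 - (n0 / n2) X2] and [X1 - (n1 / n2) X2] for [X0] and [X1] makes the form
   a binary one. *)
Lemma singular_line_pair (a : 'rV[F]_6) : ~~ polar0 a -> nval a = 0 ->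
  real_line_pair a || imaginary_line_pair iota a.
Proof.
move=> na n0.
pose simp := (coorD, coorZ, coor_lprod, coor_row3,
  mulr0, mul0r, addr0, add0r, mulr1, mul1r).
pose e := coor a 1 * coor a 2 * coor a 4.
have := na; rewrite !negb_and => /or3P[] ai.
- apply: (binary_line_pair (u := row3 1 0 (coor a 4 / coor a 1))
    (v := row3 0 1 (coor a 2 / coor a 1))
    (A := coor a 0) (B := coor a 1) (C := coor a 3)) => //.
  apply: coorP6; rewrite !simp //.
  + by apply: (char2_eq (e := - (coor a 0 * coor a 4 / coor a 1))) => //; field.
  + by apply: (char2_eq (e := - (coor a 3 * coor a 2 / coor a 1))) => //; field.
  (* The coefficient of the eliminated variable's square is the only one that calls on [nval a = 0];
     the denominators are cleared first. *)
  apply: (mulIf (expf_neq0 2 ai)).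
  apply: (char2_eq (e := coor a 5 * coor a 1 ^+ 2 + e)) => //.
  by rewrite -[LHS]add0r -{1}n0 /nval /qval /e; field.
- apply: (binary_line_pair (u := row3 1 (coor a 4 / coor a 2) 0)
    (v := row3 0 (coor a 1 / coor a 2) 1)
    (A := coor a 0) (B := coor a 2) (C := coor a 5)) => //.
  apply: coorP6; rewrite !simp //.
  + by apply: (char2_eq (e := - (coor a 0 * coor a 4 / coor a 2))) => //; field.
  + apply: (mulIf (expf_neq0 2 ai)).
    apply: (char2_eq (e := coor a 3 * coor a 2 ^+ 2 + e)) => //.
    by rewrite -[LHS]add0r -{1}n0 /nval /qval /e; field.
  by apply: (char2_eq (e := - (coor a 5 * coor a 1 / coor a 2))) => //; field.
apply: (binary_line_pair (u := row3 (coor a 2 / coor a 4) 1 0)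
  (v := row3 (coor a 1 / coor a 4) 0 1)
  (A := coor a 3) (B := coor a 4) (C := coor a 5)) => //.
apply: coorP6; rewrite !simp //.
+ apply: (mulIf (expf_neq0 2 ai)).
  apply: (char2_eq (e := coor a 0 * coor a 4 ^+ 2 + e)) => //.
  by rewrite -[LHS]add0r -{1}n0 /nval /qval /e; field.
+ by apply: (char2_eq (e := - (coor a 3 * coor a 2 / coor a 4))) => //; field.
by apply: (char2_eq (e := - (coor a 5 * coor a 1 / coor a 4))) => //; field.
Qed.

End Classification.

(** * Counting *)

Lemma card_kermx (F : finFieldType) m n (A : 'M[F]_(m, n)) :
  #|[set x : 'rV[F]_m | x *m A == 0]| = (#|F| ^ (m - \rank A))%N.
Proof.
pose f (z : 'rV[F]_(\rank (kermx A))) := z *m row_base (kermx A).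
have -> : [set x : 'rV[F]_m | x *m A == 0] = f @: [set: 'rV[F]_(\rank (kermx A))].
  apply/setP=> x; rewrite inE -(sameP sub_kermxP eqP) -(eq_row_base (kermx A)).
  by apply/submxP/imsetP => [[z ->]|[z _ ->]]; exists z; rewrite ?inE.
rewrite card_imset; last exact/row_free_inj/row_base_free.
by rewrite cardsT card_mx mul1n mxrank_ker.
Qed.

(** Full column rank makes the map onto, and every fibre is then a translate of the kernel. *)
Lemma card_mulmx_fibre (F : finFieldType) m n (A : 'M[F]_(m, n)) (v : 'rV[F]_n) :
  \rank A = n -> #|[set x : 'rV[F]_m | x *m A == v]| = (#|F| ^ (m - n))%N.
Proof.
move=> rkA; have /submxP[x0 ->] : (v <= A)%MS by apply: submx_full; rewrite /row_full rkA.
rewrite -[in RHS]rkA -card_kermx -[RHS](card_imset _ (addrI x0)).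
apply: eq_card => x; rewrite inE -subr_eq0 -mulmxBl.
apply/idP/imsetP => [xA|[z]]; last by rewrite inE => zA ->; rewrite addrAC subrr add0r.
by exists (x - x0); rewrite ?inE // addrC subrK.
Qed.

Lemma dotE (F : finFieldType) n (x w : 'rV[F]_n) : x *m w^T = (dot x w)%:M.
Proof.
by apply/rowP=> i; rewrite ord1 !mxE eqxx mulr1n; apply: eq_bigr => k _; rewrite mxE.
Qed.

Lemma card_dot (F : finFieldType) n (w : 'rV[F]_n) (t : F) : w != 0 ->
  #|[set x | dot x w == t]| = (#|F| ^ (n - 1))%N.
Proof.
move=> w0; rewrite -(@card_mulmx_fibre _ _ _ w^T t%:M) ?mxrank_tr ?rank_rV ?w0 //.
apply: eq_card => x; rewrite !inE dotE.
by apply/eqP/eqP => [->//|/(congr1 (fun A : 'M_1 => A 0 0))]; rewrite !mxE !mulr1n.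
Qed.

Lemma card_dot2 (F : finFieldType) n (w w' : 'rV[F]_n) (t t' : F) :
    w != 0 -> (forall k, w' != k *: w) ->
  #|[set x | (dot x w == t) && (dot x w' == t')]| = (#|F| ^ (n - 2))%N.
Proof.
move=> w0 nw'; pose A := col_mx w w'.
have rkA : \rank A^T = 2%N.
  apply/eqP; rewrite mxrank_tr eqn_leq rank_leq_row /=.
  (* The row space of [A] contains [w'], which is not in the line of [w], so its dimension exceeds
     1. *)
  have : (w < A)%MS.
    rewrite ltmxE; apply/andP; split.
      by rewrite -addsmxE addsmxSl.
    rewrite col_mx_sub submx_refl /=; apply/sub_rVP=> -[k w'E].
    by case/eqP: (nw' k).
  by rewrite ltmxErank rank_rV w0 => /andP[].
rewrite -(@card_mulmx_fibre _ _ _ A^T (row_mx t%:M t'%:M) rkA).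
apply: eq_card => x; rewrite !inE tr_col_mx mul_mx_row !dotE.
apply/andP/eqP => [[/eqP-> /eqP->]//|/eq_row_mx[]].
move=> /(congr1 (fun A : 'M_1 => A 0 0)) + /(congr1 (fun A : 'M_1 => A 0 0)).
by rewrite !mxE !mulr1n => -> ->.
Qed.

Lemma dotC (F : finFieldType) n (a b : 'rV[F]_n) : dot a b = dot b a.
Proof. by apply: eq_bigr => k _; rewrite mulrC. Qed.

Lemma dotZl (F : finFieldType) n k (a b : 'rV[F]_n) : dot (k *: a) b = k * dot a b.
Proof. by rewrite mulr_sumr; apply: eq_bigr => i _; rewrite mxE mulrA. Qed.

Lemma dotZr (F : finFieldType) n k (a b : 'rV[F]_n) : dot a (k *: b) = k * dot a b.
Proof. by rewrite dotC dotZl dotC. Qed.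

Lemma dot0l (F : finFieldType) n (b : 'rV[F]_n) : dot 0 b = 0.
Proof. by rewrite -(scale0r 0) dotZl mul0r. Qed.

Lemma dot0r (F : finFieldType) n (b : 'rV[F]_n) : dot b 0 = 0.
Proof. by rewrite dotC dot0l. Qed.

Lemma dot_delta (F : finFieldType) n (a : 'rV[F]_n) i :
  dot a (delta_mx 0 i) = a 0 i.
Proof.
rewrite /dot (bigD1 i) //= mxE !eqxx mulr1 big1 ?addr0 // => j ne_ji.
by rewrite mxE (negPf ne_ji) andbF mulr0.
Qed.

Lemma dotBr (F : finFieldType) n (a b c : 'rV[F]_n) :
  dot a (b - c) = dot a b - dot a c.
Proof. by rewrite -sumrB; apply: eq_bigr => i _; rewrite !mxE mulrBr. Qed.

(** * From hyperplanes to coefficient vectors *)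

Lemma hyperplane_inj (F : finFieldType) (a b : 'rV[F]_6) : a != 0 -> b != 0 ->
  hyperplane a = hyperplane b -> exists2 k, k != 0 & b = k *: a.
Proof.
move=> a0 b0 eq_ab; have [i ai] := rV0Pn _ a0.
have bE : b = (b 0 i / a 0 i) *: a.
  apply/rowP=> j; rewrite mxE mulrAC; apply: (canRL (mulfK ai)).
  (* This vector lies on the hyperplane of [a] by construction; lying on that of [b] gives the
     proportionality of the coordinates [i] and [j]. *)
  have : a 0 i *: delta_mx 0 j - a 0 j *: delta_mx 0 i \in hyperplane b.
    rewrite -eq_ab inE -/(dot a _) dotBr !dotZr !dot_delta.
    by rewrite mulrC subrr.
  rewrite inE -/(dot b _) dotBr !dotZr !dot_delta subr_eq0 => /eqP.
  by rewrite mulrC => ->; rewrite mulrC.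
by exists (b 0 i / a 0 i) => //; apply: contraNneq b0 => k0; rewrite bE k0 scale0r.
Qed.

Definition forms_through (F : finFieldType) (y : 'rV[F]_6) (C : pred 'rV[F]_6) :
  {set 'rV[F]_6} := [set a | [&& a != 0, C a & dot a y == 0]].

Lemma point_vpick (F : finFieldType) (P : {vspace 'rV[F]_6}) : is_point P ->
  vpick P != 0 /\ P = <[vpick P]>%VS.
Proof.
move=> /eqP dimP; have v0 : vpick P != 0.
  by rewrite vpick0 -dimv_eq0 dimP.
split=> //; apply/esym/eqP; rewrite eqEdim dim_vline v0 dimP andbT.
by rewrite -memvE memv_pick.
Qed.

Lemma card_neq0 (F : finFieldType) : #|[set k : F | k != 0]| = (#|F| - 1)%N.
Proof.
rewrite -[in RHS]cardsT (cardsD1 0 [set: F]) inE addnC addnK.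
by apply: eq_card => k; rewrite !inE andbT.
Qed.

(** Each hyperplane comes from exactly [#|F| - 1] coefficient vectors, all of them in [C] as soon as
    one is. Containing the point is tested on its generator [vpick P]. *)
Lemma nb_throughE (F : finFieldType) (P : {vspace 'rV[F]_6}) (C : pred 'rV[F]_6) :
    is_point P -> (forall k a, k != 0 -> C a -> C (k *: a)) ->
  (nb_through P (hyperplanes_of C) * (#|F| - 1))%N
    = #|forms_through (vpick P) C|.
Proof.
move=> /point_vpick[y0 PE] CZ; set y := vpick P in y0 PE *.
have subP a : (P \subset hyperplane a) = (dot a y == 0).
  apply/subsetP/eqP => [/(_ y)|ay v]; rewrite inE -/(dot a _).
    by rewrite memv_pick => /(_ isT)/eqP.
  by rewrite PE => /vlineP[k ->]; rewrite dotZr ay mulr0.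
rewrite (@card_fibres _ _ (@hyperplane F) _ (#|F| - 1)).
  congr (_ * _)%N; apply: eq_card => H; rewrite inE.
  apply/andP/imsetP => [[/imsetP[a] + ->]|[a + ->]]; rewrite inE.
    by case/andP=> a0 Ca; rewrite subP => ay; exists a; rewrite // inE a0 Ca.
  by case/and3P=> a0 Ca ay; rewrite subP ay imset_f // inE a0.
move=> a; rewrite inE => /and3P[a0 Ca ay].
rewrite -card_neq0 -(card_imset (f := fun k => k *: a)) => [|k l /eqP].
  apply: eq_card => b; rewrite !inE; apply/andP/imsetP => [[/and3P[b0 Cb _]]|].
    by move=> /eqP/esym/(hyperplane_inj a0 b0)[k k0 ->]; exists k; rewrite ?inE.
  case=> k; rewrite inE => k0 ->; rewrite scaler_eq0 negb_or k0 a0 CZ //=.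
  rewrite dotZl (eqP ay) mulr0 eqxx; split=> //; apply/eqP/setP=> v.
  by rewrite !inE -!/(dot _ _) dotZl mulf_eq0 (negPf k0).
by rewrite -subr_eq0 -scalerBl scaler_eq0 (negPf a0) orbF subr_eq0 => /eqP.
Qed.

(** For a form this is the nucleus. For a point it lists the off-diagonal entries of the matrix in
    the matching order, so that incidence becomes a sum of two dot products. *)
Definition polar (F : finFieldType) (a : 'rV[F]_6) : 'rV[F]_3 :=
  row3 (coor a 4) (coor a 2) (coor a 1).

Definition diagc (F : finFieldType) (a : 'rV[F]_6) : 'rV[F]_3 :=
  row3 (coor a 0) (coor a 3) (coor a 5).

Definition sqrow (F : finFieldType) n (c : 'rV[F]_n) : 'rV[F]_n :=
  map_mx (fun x => x ^+ 2) c.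

Definition prodc (F : finFieldType) (c : 'rV[F]_3) : F :=
  coor c 0 * coor c 1 * coor c 2.

Lemma polar0E (F : finFieldType) (a : 'rV[F]_6) : polar0 a = (polar a == 0).
Proof.
by rewrite row3_eq0 /polar0 andbA andbC (andbC (coor a 1 == 0)).
Qed.

Lemma dot_polar_diag (F : finFieldType) (a y : 'rV[F]_6) :
  dot a y = dot (polar a) (polar y) + dot (diagc a) (diagc y).
Proof. by rewrite dot6E !dot3E !coor_row3; ring. Qed.

(** For a fixed nucleus the discriminant is thus affine in the diagonal, which is why the counts
    below are made nucleus by nucleus. *)
Lemma nval_polar_diag (F : finFieldType) (a : 'rV[F]_6) :
  nval a = dot (diagc a) (sqrow (polar a)) + 3%:R * prodc (polar a).
Proof. by rewrite /nval /qval dot3E /prodc !coor_map !coor_row3; ring. Qed.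

Lemma card_polar_diag (F : finFieldType) (Q : 'rV[F]_3 -> 'rV[F]_3 -> bool) :
  #|[set a : 'rV[F]_6 | Q (polar a) (diagc a)]|
    = (\sum_c #|[set d | Q c d]|)%N.
Proof.
pose f (p : 'rV[F]_3 * 'rV[F]_3) : 'rV[F]_6 :=
  row6 [:: coor p.2 0; coor p.1 2; coor p.1 1; coor p.2 1; coor p.1 0; coor p.2 2].
have polarf p : polar (f p) = p.1.
  by apply: coorP3; rewrite coor_row3 coor_row6.
have diagf p : diagc (f p) = p.2.
  by apply: coorP3; rewrite coor_row3 coor_row6.
have -> : [set a : 'rV[F]_6 | Q (polar a) (diagc a)] = f @: [set p | Q p.1 p.2].
  apply/setP=> a; rewrite inE; apply/idP/imsetP => [Qa|[p]].
    exists (polar a, diagc a); rewrite ?inE //.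
    by apply: coorP6; rewrite coor_row6 //= coor_row3.
  by rewrite inE => Qp ->; rewrite polarf diagf.
rewrite card_imset => [|p p' eq_p]; last first.
  by rewrite [p]surjective_pairing [p']surjective_pairing -!polarf -!diagf eq_p.
rewrite -sum1_card (eq_bigl (fun p => true && Q p.1 p.2)) => [|p]; last by rewrite inE.
rewrite -(pair_big_dep xpredT Q (fun _ _ => 1%N)) /=.
by apply: eq_bigr => c _; rewrite -sum1_card; apply: eq_bigl => d; rewrite inE.
Qed.

Lemma card_dot0 (F : finFieldType) n (w : 'rV[F]_n) :
  #|[set x | dot x w == 0]| = (if w == 0%R then #|F| ^ n else #|F| ^ (n - 1))%N.
Proof.
have [->|w0] := eqVneq w 0; last by rewrite card_dot.
rewrite -[n in RHS]mul1n -card_mx -cardsT; apply: eq_card => x.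
by rewrite !inE dot0r eqxx.
Qed.

Lemma card_multiples (F : finFieldType) n (b : 'rV[F]_n) : b != 0 ->
  #|[set k *: b | k : F]| = #|F|.
Proof.
move=> b0; rewrite card_imset // => k l /eqP.
by rewrite -subr_eq0 -scalerBl scaler_eq0 (negPf b0) orbF subr_eq0 => /eqP.
Qed.

Lemma sum_const_card (T : finType) (A : {set T}) (f : T -> nat) n :
  {in A, forall x, f x = n} -> (\sum_(x in A) f x = #|A| * n)%N.
Proof. by move=> fA; rewrite -sum_nat_const; apply: eq_bigr. Qed.

(** * Double lines and nonsingular forms through a point *)

Section Count.

Variables (F : finFieldType) (y : 'rV[F]_6).
Hypotheses (char2 : 2%N \in [pchar F]) (y0 : y != 0).

Let q := #|F|.
Let h2 : 2%:R = 0 :> F := pchar2_2 char2.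

(** Only the zero nucleus contributes, and incidence is then a linear condition on the diagonal,
    void when [diagc y = 0]. The [+ 1] restores the zero form. *)
Lemma card_double :
  (#|forms_through y (@double_line F)| + 1)%N
    = (if diagc y == 0%R then q ^ 3 else q ^ 2)%N.
Proof.
have -> : (#|forms_through y (@double_line F)| + 1)%N
    = #|[set a | (polar a == 0) && (dot (polar a) (polar y)
         + dot (diagc a) (diagc y) == 0)]|.
  rewrite [RHS](cardsD1 0) inE.
  have p0 : polar (0 : 'rV[F]_6) = 0 by apply/eqP; rewrite -polar0E /polar0 !coor0 eqxx.
  rewrite -dot_polar_diag p0 dot0l !eqxx addnC; congr (_ + _)%N.
  by apply: eq_card => a; rewrite !inE double_lineE // polar0E -dot_polar_diag.
rewrite (card_polar_diag (fun c d => (c == 0) && (dot c _ + dot d _ == 0))).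
rewrite (bigD1 0) //= big1 ?addn0 => [|c /negPf c0].
  rewrite -(card_dot0 (diagc y)); apply: eq_card => d.
  by rewrite !inE eqxx dot0l add0r.
by apply: eq_card0 => d; rewrite !inE c0.
Qed.

(** The number of nonsingular forms through the point whose nucleus is [c]. *)
Let npt (c : 'rV[F]_3) := #|[set d | (dot d (sqrow c) + 3%:R * prodc c != 0)
  && (dot c (polar y) + dot d (diagc y) == 0)]|.

Lemma card_nonsingular_sum :
  #|forms_through y (@nonsingular F)| = (\sum_c npt c)%N.
Proof.
rewrite -(card_polar_diag (fun c d => (dot d (sqrow c) + 3%:R * prodc c != 0)
  && (dot c (polar y) + dot d (diagc y) == 0))).
apply: eq_card => a; rewrite !inE nonsingularE // -nval_polar_diag -dot_polar_diag.
case: eqVneq => [->|//] /=; rewrite polar0_nval ?eqxx //.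
by rewrite /polar0 !coor0 eqxx.
Qed.

Lemma sqrow_eq0 (c : 'rV[F]_3) : (sqrow c == 0) = (c == 0).
Proof.
apply/eqP/eqP => [c0|->]; apply/rowP=> i; rewrite !mxE ?expr0n //.
by have /eqP := congr1 (fun A : 'rV_3 => A 0 i) c0; rewrite !mxE expf_eq0 => /eqP.
Qed.

Lemma polar_neq0 : diagc y = 0 -> polar y != 0.
Proof.
move/eqP; rewrite row3_eq0 => /and3P[/eqP e0 /eqP e3 /eqP e5].
apply: contraNneq y0 => /eqP; rewrite row3_eq0.
case/and3P=> /eqP e4 /eqP e2 /eqP e1.
by apply/eqP/coorP6; rewrite coor0.
Qed.

Lemma card_dot_neq (w : 'rV[F]_3) (t : F) : w != 0 ->
  #|[set d | dot d w != t]| = (q ^ 3 - q ^ 2)%N.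
Proof.
move=> w0; have := card_dot t w0; rewrite -/q => <-.
rewrite cardsCs card_mx; congr (_ - _)%N.
by apply: eq_card => d; rewrite !inE negbK.
Qed.

(** Incidence concerns the nucleus alone. It leaves [q ^ 2 - 1] nonzero nuclei, and for each of them
    the discriminant vanishes on an affine plane of diagonals. The zero nucleus contributes
    nothing. *)
Lemma card_nonsingular_diag0 : diagc y = 0 ->
  #|forms_through y (@nonsingular F)| = ((q ^ 2 - 1) * (q ^ 3 - q ^ 2))%N.
Proof.
move=> d0; rewrite card_nonsingular_sum.
pose A := [set c | dot c (polar y) == 0] :\ 0.
rewrite (bigID (mem A)) /= [X in (_ + X)%N]big1 ?addn0 => [|c].
  rewrite (sum_const_card (n := (q ^ 3 - q ^ 2)%N)) => [|c].
    congr (_ * _)%N; have := cardsD1 0 [set c | dot c (polar y) == 0].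
    rewrite inE dot0l eqxx -/A card_dot ?polar_neq0 // => ->.
    by rewrite addnC addnK.
  rewrite !inE => /andP[c0 cp]; rewrite /npt d0 (eqP cp).
  rewrite -(card_dot_neq (- (3%:R * prodc c)) (w := sqrow c)) ?sqrow_eq0 //.
  by apply: eq_card => d; rewrite !inE dot0r addr0 eqxx andbT addr_eq0.
rewrite !inE negb_and negbK => ncA; apply: eq_card0 => d; rewrite !inE d0 dot0r addr0.
case/orP: ncA => [/eqP->|/negPf->]; last by rewrite andbF.
have -> : sqrow (0 : 'rV[F]_3) = 0 by apply/eqP; rewrite sqrow_eq0 eqxx.
by rewrite /prodc !coor0 dot0r !mulr0 addr0 eqxx.
Qed.

(** For the [q ^ 3 - q] nuclei that are not multiples of [s], the conditions on the diagonal are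
    independent: [q ^ 2] diagonals satisfy incidence, and [q] of these make the discriminant vanish.
    For a nonzero multiple of [s], incidence fixes the discriminant, so all [q ^ 2] diagonals count
    or none does. *)
Lemma card_nonsingular_diag (s : 'rV[F]_3) : sqrow s = diagc y -> s != 0 ->
  #|forms_through y (@nonsingular F)|
    = ((q ^ 3 - q) * (q ^ 2 - q)
       + (dot s (polar y) != prodc s) * ((q - 1) * q ^ 2))%N.
Proof.
move=> sE s0; rewrite card_nonsingular_sum.
pose A := [set k *: s | k : F].
have cardA : #|A| = q by apply: card_multiples.
rewrite (bigID (mem A)) /= addnC; congr (_ + _)%N.
  rewrite (eq_bigl (fun c => c \in ~: A)) => [|c]; last by rewrite inE.
  rewrite (sum_const_card (n := (q ^ 2 - q)%N)) => [|c].
    by rewrite cardsCs setCK cardA card_mx.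
  rewrite inE => nAc.
  have c0 : c != 0.
    by apply: contraNneq nAc => ->; apply/imsetP; exists 0; rewrite ?scale0r.
  have dy0 : diagc y != 0 by rewrite -sE sqrow_eq0.
  (* Taking square roots, a dependence between the two conditions would make [c] a multiple of
     [s]. *)
  have nprop k : sqrow c != k *: diagc y.
    apply: contraNneq nAc => cE; have [r rE] := sqrt_pchar2 k char2.
    apply/imsetP; exists r => //; apply/rowP=> i; rewrite mxE.
    apply: (sqr_inj_pchar2 char2); rewrite /= exprMn rE.
    by have := congr1 (fun A : 'rV_3 => A 0 i) cE; rewrite -sE !mxE.
  have := card_dot (- dot c (polar y)) dy0; rewrite -/q => <-.
  have := card_dot2 (- dot c (polar y)) (- (3%:R * prodc c)) dy0 nprop.
  rewrite expn1 -/q => <-.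
  rewrite -(cardsID [set d | dot d (sqrow c) == - (3%:R * prodc c)]).
  rewrite (_ : _ :&: _ = [set d | (dot d (diagc y) == - dot c (polar y))
    && (dot d (sqrow c) == - (3%:R * prodc c))]); last first.
    by apply/setP=> d; rewrite !inE.
  rewrite addnC addnK; apply: eq_card => d; rewrite !inE -addr_eq0.
  by congr (_ && _); rewrite addrC addr_eq0.
(* On a multiple of [s], both conditions involve [d] only through [dot d (diagc y)], which incidence
   determines. *)
have Ak (k : F) d : dot (k *: s) (polar y) + dot d (diagc y) = 0 ->
    dot d (sqrow (k *: s)) + 3%:R * prodc (k *: s)
      = k ^+ 3 * (dot s (polar y) - prodc s).
  have -> : sqrow (k *: s) = k ^+ 2 *: diagc y.
    by rewrite -sE; apply/rowP=> i; rewrite !mxE exprMn.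
  move/eqP; rewrite addrC addr_eq0 => /eqP.
  rewrite dotZr => ->; rewrite dotZl /prodc !coorZ.
  apply: (char2_eq (e := k ^+ 3 * (2%:R * prodc s - dot s (polar y)))) => //.
  by rewrite /prodc; ring.
case: eqVneq => [D0|D0] /=.
  rewrite mul0n big1 // => c /imsetP[k _ ->]; apply: eq_card0 => d; rewrite !inE.
  by apply/negP => /andP[/negP nz /eqP/Ak e]; apply: nz; rewrite e D0 subrr mulr0.
rewrite mul1n (bigD1 0) /=; last by apply/imsetP; exists 0; rewrite ?scale0r.
rewrite [npt 0](_ : _ = 0%N) ?add0n; last first.
  apply: eq_card0 => d; rewrite !inE; apply/negP => /andP[/negP nz].
  rewrite -(scale0r s) => /eqP/Ak e; apply: nz.
  by rewrite -(scale0r s) e expr0n mul0r.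
rewrite (eq_bigl (fun c => c \in A :\ 0)) => [|c]; last by rewrite !inE andbC.
rewrite (sum_const_card (n := (q ^ 2)%N)) => [|c].
  have A0 : 0 \in A by apply/imsetP; exists 0; rewrite ?scale0r.
  by have := cardsD1 0 A; rewrite cardA A0 => ->; rewrite addnC addnK.
rewrite !inE => /andP[c0 /imsetP[k _ cE]].
have dy0 : diagc y != 0 by rewrite -sE sqrow_eq0.
have := card_dot (- dot c (polar y)) dy0; rewrite -/q => <-.
apply: eq_card => d; rewrite !inE -addr_eq0 [dot d (diagc y) + _]addrC.
case: (eqVneq (_ + dot d (diagc y)) 0) => [|_]; rewrite ?andbF // andbT.
rewrite {}cE in c0 * => /Ak->; rewrite mulf_neq0 ?subr_eq0 // expf_neq0 //.
by apply: contraNneq c0 => ->; rewrite scale0r.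
Qed.

End Count.

(** * Real line pairs through a point *)

Lemma symmx_col (F : finFieldType) (b : 'rV[F]_3) (y : 'rV[F]_6) :
  (coor (b *m symmx y) 0
    = coor b 0 * coor y 0 + coor b 1 * coor y 1 + coor b 2 * coor y 2) *
  (coor (b *m symmx y) 1
    = coor b 0 * coor y 1 + coor b 1 * coor y 3 + coor b 2 * coor y 4) *
  (coor (b *m symmx y) 2
    = coor b 0 * coor y 2 + coor b 1 * coor y 4 + coor b 2 * coor y 5).
Proof.
rewrite [coor (_ *m _) 0]mxE [coor (_ *m _) 1]mxE [coor (_ *m _) 2]mxE.
by rewrite !sum_coor3 !mxE !inordK.
Qed.

Lemma dot_lprod (F : finFieldType) (b c : 'rV[F]_3) (y : 'rV[F]_6) :
  dot (lprod b c) y = dot c (b *m symmx y).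
Proof. by rewrite dot6E !coor_lprod dot3E !symmx_col; ring. Qed.

(** Since [proportional] requires a nonzero factor, the zero vector has to be added to obtain the
    whole line spanned by [b]. *)
Lemma proportional_multiples (F : finFieldType) (b c : 'rV[F]_3) :
  b != 0 -> (c == 0) || proportional b c = (c \in [set k *: b | k : F]).
Proof.
move=> b0; apply/orP/imsetP => [[/eqP->|/proportional_sym/existsP[k]]|[k _ ->]].
- by exists 0; rewrite ?scale0r.
- by case/andP=> _ /eqP->; exists k.
have [->|k0] := eqVneq k 0; first by rewrite scale0r eqxx; left.
right; apply: proportional_sym; apply/existsP; exists k.
by rewrite k0 eqxx.
Qed.

Section RealCount.

Variables (F : finFieldType) (y : 'rV[F]_6) (s : 'rV[F]_3).
Hypotheses (char2 : 2%N \in [pchar F]) (sE : sqrow s = diagc y).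

Let q := #|F|.
Let h2 : 2%:R = 0 :> F := pchar2_2 char2.

Let pairs : {set 'rV[F]_3 * 'rV[F]_3} :=
  [set p | [&& p.1 != 0, p.2 != 0, ~~ proportional p.1 p.2
             & dot (lprod p.1 p.2) y == 0]].

(* [lprod b c] determines the pair [(b, c)] up to [(k b, c / k)] and swapping. *)
Lemma card_pairs :
  #|pairs| = (#|forms_through y (@real_line_pair F)| * (2 * (q - 1)))%N.
Proof.
pose f (p : 'rV[F]_3 * 'rV[F]_3) := lprod p.1 p.2.
have fE : f @: pairs = forms_through y (@real_line_pair F).
  apply/setP=> a; rewrite inE; apply/imsetP/and3P => [[[b c]]|].
    rewrite inE /f => /and4P[/= b0 c0 nbc bcy] ->; split=> //.
      by rewrite lprod_eq0 negb_or b0.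
    by apply/real_line_pairP; exists b, c.
  case=> a0 /real_line_pairP[b [c [nbc aE]]] ay; exists (b, c) => //.
  move: a0 ay; rewrite aE lprod_eq0 => /norP[b0 c0] bcy.
  by rewrite inE /= b0 c0 nbc.
rewrite -fE; apply: card_fibres => -[b c]; rewrite inE /= => /and4P[b0 c0 nbc bcy].
(* Parametrises the fibre: the boolean tells whether the factors keep their order, the scalar
   rescales them. Injectivity across the two orders is the non-proportionality of [b] and [c]. *)
pose g (x : bool * F) := if x.1 then (x.2 *: b, x.2^-1 *: c) else (x.2 *: c, x.2^-1 *: b).
have injZ (d : 'rV[F]_3) : d != 0 -> injective (fun k : F => k *: d).
  move=> d0 k l /eqP; rewrite -subr_eq0 -scalerBl scaler_eq0 (negPf d0) orbF.
  by rewrite subr_eq0 => /eqP.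
rewrite [LHS](_ : _ = #|g @: [set x | x.2 != 0]|).
  rewrite card_in_imset => [|[[] k] [[] l]]; last 4 first.
  - by rewrite !inE /= => _ _ [/injZ->].
  - rewrite !inE /= => k0 l0 [kl _]; case/negP: nbc; apply/existsP.
    exists (k^-1 * l); rewrite mulf_neq0 ?invr_eq0 //.
    by rewrite -scalerA -kl scalerA mulVf // scale1r eqxx.
  - rewrite !inE /= => k0 l0 [kl _]; case/negP: nbc; apply/existsP.
    exists (l^-1 * k); rewrite mulf_neq0 ?invr_eq0 //.
    by rewrite -scalerA kl scalerA mulVf // scale1r eqxx.
  - by rewrite !inE /= => _ _ [/injZ->].
  rewrite -card_neq0 -[2%N]card_bool -cardsT -cardsX.
  by apply: eq_card => -[e k]; rewrite !inE.
apply: eq_card => -[b' c']; rewrite inE /f; apply/andP/imsetP => [[]|[[e k]]].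
  rewrite inE => /and4P[/= b'0 c'0 _ _] /eqP eq_bc.
  have bc0 : lprod b c != 0 by rewrite lprod_eq0 negb_or b0.
  have cancel d k : d != 0 -> k != 0 ->
      forall e e', lprod (k *: d) e = lprod d e' -> e = k^-1 *: e'.
    move=> d0 k0 e e' eq_de; apply/eqP; rewrite -subr_eq0.
    suff /eqP : lprod d (e - k^-1 *: e') = 0 by rewrite lprod_eq0 (negPf d0).
    rewrite lprodDr -scaleNr lprodZr -eq_de lprodZl scalerA mulNr mulVf //.
    by rewrite scaleN1r subrr.
  have [] := lprod_prime bc0 (esym eq_bc) => /proportional_sym/existsP[k];
    case/andP=> k0 /eqP b'E; rewrite b'E in eq_bc.
    exists (true, k); rewrite ?inE // /g /= b'E; congr (_, _).
    exact: cancel b0 k0 _ _ eq_bc.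
  exists (false, k); rewrite ?inE // /g /= b'E; congr (_, _).
  by apply: cancel c0 k0 _ _ _; rewrite eq_bc lprod_sym.
rewrite inE /= => k0; have kV : k^-1 != 0 by rewrite invr_eq0.
have nprop (d d' : 'rV[F]_3) : ~~ proportional d d' ->
    ~~ proportional (k *: d) (k^-1 *: d').
  apply: contra => /existsP[l /andP[l0 /eqP ddE]]; apply/existsP.
  exists (k^-1 * l * k^-1); rewrite !mulf_neq0 //=.
  by rewrite -scalerA -scalerA -ddE scalerA mulVf // scale1r.
have prodE (d d' : 'rV[F]_3) : lprod (k *: d) (k^-1 *: d') = lprod d d'.
  by rewrite lprodZl lprodZr scalerA mulfV // scale1r.
case: e => -[-> ->]; rewrite inE /= prodE !scaler_eq0 !negb_or k0 kV b0 c0 /=.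
  by rewrite nprop // bcy eqxx.
rewrite lprod_sym bcy eqxx nprop //.
by apply: contra nbc => /proportional_sym.
Qed.

(** The off-diagonal terms of the symmetric matrix occur twice and cancel; what is left is a sum of
    squares, hence the square of a sum. *)
Lemma dot_symmx (b : 'rV[F]_3) : dot b (b *m symmx y) = dot b s ^+ 2.
Proof.
have sq i : coor s i ^+ 2 = coor (diagc y) i by rewrite -sE coor_map.
have [[s0 s1] s2] := (sq 0, sq 1, sq 2)%N; rewrite !coor_row3 in s0 s1 s2.
rewrite !dot3E !symmx_col -s0 -s1 -s2.
apply: (char2_eq (e := coor b 0 * coor b 1 * (coor y 1 - coor s 0 * coor s 1)
  + coor b 0 * coor b 2 * (coor y 2 - coor s 0 * coor s 2)
  + coor b 1 * coor b 2 * (coor y 4 - coor s 1 * coor s 2))) => //.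
by ring.
Qed.

(** The partners of [b] are the solutions [c] of [b M c^T = 0] that are not multiples of [b]. The
    solutions form a plane, or the whole space if [b M = 0]. The multiples of [b] among them are all
    [q] if [dot b s = 0], and only 0 otherwise. The removed part is put on the left to avoid
    truncated subtraction. *)
Lemma card_partners (b : 'rV[F]_3) : b != 0 ->
  (#|[set c | [&& c != 0%R, ~~ proportional b c & dot (lprod b c) y == 0%R]]|
     + (1 + (dot b s == 0%R) * (q - 1))
   = q ^ 2 + (b *m symmx y == 0%R) * (q ^ 3 - q ^ 2))%N.
Proof.
move=> b0; pose H := [set c | dot c (b *m symmx y) == 0].
pose A := [set k *: b | k : F].
have -> : (q ^ 2 + (b *m symmx y == 0%R) * (q ^ 3 - q ^ 2))%N = #|H|.
  rewrite card_dot0 -/q; case: (_ == _); rewrite ?mul1n ?addn0 //.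
  by rewrite subnKC // leq_pexp2l // ltnW ?finNzRing_gt1.
have -> : (1 + (dot b s == 0%R) * (q - 1))%N = #|H :&: A|.
  have [bs|bs] := eqVneq (dot b s) 0.
    rewrite mul1n subnKC ?(ltnW (finNzRing_gt1 F)) // -[q](card_multiples b0).
    apply: eq_card => c; rewrite !inE; case: imsetP => [[k _ ->]|]; rewrite ?andbF //.
    by rewrite dotZl dot_symmx bs expr0n mulr0 eqxx.
  rewrite mul0n addn0 -[LHS](cards1 (0 : 'rV[F]_3)); apply: eq_card => c; rewrite !inE.
  apply/eqP/andP=> [->|[+ /imsetP[k _ cE]]].
    by rewrite dot0l; split=> //; apply/imsetP; exists 0; rewrite ?scale0r.
  rewrite cE dotZl dot_symmx mulf_eq0 expf_eq0 (negPf bs) orbF => /eqP->.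
  by rewrite scale0r.
rewrite -(cardsID A H) addnC; congr (_ + _)%N; apply: eq_card => c.
by rewrite !inE -proportional_multiples // negb_or dot_lprod andbA.
Qed.

(** Sums the number of partners over the nonzero [b]. Each [- 1] next to a cardinal removes [b = 0],
    which satisfies both conditions. *)
Lemma card_pairs_sum :
  (#|pairs| + (q ^ 3 - 1) + (#|[set b | dot b s == 0%R]| - 1) * (q - 1)
   = (q ^ 3 - 1) * q ^ 2
     + (#|[set b : 'rV[F]_3 | b *m symmx y == 0%R]| - 1) * (q ^ 3 - q ^ 2))%N.
Proof.
pose B := [set~ (0 : 'rV[F]_3)].
have cardB : #|B| = (q ^ 3 - 1)%N.
  by rewrite cardsC1 card_mx subn1.
have sumB (Q : pred 'rV[F]_3) n : Q 0 ->
    (\sum_(b in B) Q b * n = (#|[set b | Q b]| - 1) * n)%N.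
  move=> Q0; rewrite -big_distrl /= (cardsD1 0) inE Q0 addnC addnK -sum1_card.
  congr (_ * _)%N; rewrite (big_mkcond (mem B)) [RHS]big_mkcond /=.
  by apply: eq_bigr => b _; rewrite !inE; case: (b == 0); case: (Q b).
have -> : #|pairs| = (\sum_(b in B)
    #|[set c | [&& c != 0%R, ~~ proportional b c & dot (lprod b c) y == 0%R]]|)%N.
  rewrite -sum1_card (eq_bigl (fun p : 'rV[F]_3 * 'rV[F]_3 => (p.1 \in B) &&
    [&& p.2 != 0, ~~ proportional p.1 p.2 & dot (lprod p.1 p.2) y == 0])); last first.
    by move=> p; rewrite !inE.
  rewrite -(pair_big_dep (mem B) (fun b c => [&& c != 0, ~~ proportional b c
    & dot (lprod b c) y == 0]) (fun _ _ => 1%N)) /=.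
  by apply: eq_bigr => b _; rewrite -sum1_card; apply: eq_bigl => c; rewrite inE.
rewrite -!sumB ?dot0l ?mul0mx ?eqxx // -cardB -!sum_nat_const -sum1_card.
rewrite -!big_split /=; apply: eq_bigr => b; rewrite !inE => b0.
by rewrite -card_partners // addnA.
Qed.

End RealCount.

(** * Rank of the matrix of a point *)

Lemma det_symmx (F : finFieldType) (y : 'rV[F]_6) :
  \det (symmx y)
    = coor y 0 * (coor y 3 * coor y 5 - coor y 4 ^+ 2)
      - coor y 1 * (coor y 1 * coor y 5 - coor y 4 * coor y 2)
      + coor y 2 * (coor y 1 * coor y 4 - coor y 3 * coor y 2).
Proof.
rewrite (expand_det_row _ ord0) !big_ord_recl big_ord0 /cofactor.
rewrite !(expand_det_row _ ord0) !big_ord_recl !big_ord0 /cofactor !det_mx11.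
by rewrite !mxE /=; ring.
Qed.

(** In characteristic 2 the determinant is the square of [dot s (polar y) - prodc s], the quantity
    that decides the extra term of [card_nonsingular_diag]. *)
Lemma rank_symmx (F : finFieldType) (y : 'rV[F]_6) (s : 'rV[F]_3) :
    2%N \in [pchar F] -> sqrow s = diagc y ->
  (\rank (symmx y) == 3%N) = (dot s (polar y) != prodc s).
Proof.
move=> char2 sE; have h2 := pchar2_2 char2.
have sq i : coor s i ^+ 2 = coor (diagc y) i by rewrite -sE coor_map.
have [[s0 s1] s2] := (sq 0, sq 1, sq 2)%N; rewrite !coor_row3 in s0 s1 s2.
rewrite -[LHS]/(row_free _) row_free_unit unitmxE unitfE; congr (~~ _).
rewrite -[RHS]subr_eq0 -[RHS]andTb -(expf_eq0 _ 2); congr (_ == 0).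
rewrite det_symmx dot3E /prodc !coor_row3 -s0 -s1 -s2.
set c0 := coor s 0; set c1 := coor s 1; set c2 := coor s 2.
set y1 := coor y 1; set y2 := coor y 2; set y4 := coor y 4.
apply: (char2_eq (e := y1 * y2 * y4 - c0 ^+ 2 * y4 ^+ 2 - c1 ^+ 2 * y2 ^+ 2
  - c2 ^+ 2 * y1 ^+ 2 - c0 * c1 * y4 * y2 - c0 * c2 * y4 * y1 - c1 * c2 * y2 * y1
  + (c0 * y4 + c1 * y2 + c2 * y1) * (c0 * c1 * c2))) => //.
by ring.
Qed.

(** A symmetric matrix with zero diagonal is alternating here, so its rank is even. This keeps the
    points of rank 1 and 3 off the nucleus plane. *)
Lemma rank_symmx_diag0 (F : finFieldType) (y : 'rV[F]_6) :
    2%N \in [pchar F] -> y != 0 -> diagc y = 0 ->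
  (\rank (symmx y) != 1%N) && (\rank (symmx y) != 3%N).
Proof.
move=> char2 y0 d0; apply/andP; split; last first.
  rewrite (@rank_symmx _ _ 0) //; last by apply/eqP; rewrite d0 sqrow_eq0.
  by rewrite dot0l /prodc coor0 !mul0r eqxx.
apply: contra (polar_neq0 y0 d0) => rk1.
have [u [v MuV]] : exists u : 'cV[F]_3, exists v : 'rV[F]_3, symmx y = u *m v.
  move: (mulmx_base (symmx y)).
  move: (col_base (symmx y)) (row_base (symmx y)); rewrite (eqP rk1) => u v <-.
  by exists u, v.
have Mij i j : symmx y i j = u i 0 * v 0 j.
  by rewrite MuV mxE big_ord_recl big_ord0 addr0.
have Mii i : symmx y i i = 0.
  move/eqP: d0; rewrite row3_eq0 => /and3P[/eqP e0 /eqP e3 /eqP e5].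
  by rewrite mxE; case: i => [[|[|[|//]]] ?].
have Mij0 i j : symmx y i j = 0.
  apply/eqP; rewrite -[_ == _]andTb -(expf_eq0 _ 2) expr2.
  have Mt : symmx y i j = symmx y j i.
    by rewrite !mxE; case: i => [[|[|[|//]]] ?]; case: j => [[|[|[|//]]] ?].
  (* For a product of a column by a row the two-by-two minors vanish; by symmetry the square of each
     entry is then a product of diagonal entries, that is, 0. *)
  have e : symmx y i j * symmx y j i = symmx y i i * symmx y j j.
    by rewrite !Mij; ring.
  by rewrite {2}Mt e Mii mul0r.
have := (Mij0 (inord 1) (inord 2), Mij0 (inord 0) (inord 2), Mij0 (inord 0) (inord 1)).
rewrite !mxE !inordK //= => -[[y4 y2] y1].
by rewrite row3_eq0 y4 y2 y1 eqxx.
Qed.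

(** * The four classes together, and the resulting distribution *)

Section Total.

Variables (F L : finFieldType) (iota : {rmorphism F -> L}) (y : 'rV[F]_6).
Hypotheses (char2 : 2%N \in [pchar F]) (cardL : #|L| = (#|F| ^ 2)%N) (y0 : y != 0).

(** Every nonzero form lies in exactly one of the four classes, and the forms through the point,
    zero included, make up a space of dimension 5. The equality is checked form by form on indicator
    functions. *)
Lemma card_forms_total :
  (#|forms_through y (@double_line F)| + #|forms_through y (@real_line_pair F)|
   + #|forms_through y (imaginary_line_pair iota)|
   + #|forms_through y (@nonsingular F)| + 1 = #|F| ^ 5)%N.
Proof.
have cardE (A : {set 'rV[F]_6}) : #|A| = (\sum_a (a \in A))%N.
  by rewrite -sum1_card big_mkcond; apply: eq_bigr => a _; case: (a \in A).
have := card_dot 0 y0; rewrite /= => <-.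
rewrite -[X in (_ + X)%N](cards1 (0 : 'rV[F]_6)) !cardE -!big_split /=.
apply: eq_bigr => a _.
rewrite !inE; have [->|a0] := eqVneq a 0; first by rewrite dot0l eqxx.
case: eqP => _; rewrite ?andbF // !andbT /= addn0.
have h2 := pchar2_2 char2; rewrite double_lineE // nonsingularE //.
have := real_line_pair_singular char2 a0.
have := imaginary_line_pair_singular (iota := iota) char2 a0.
have := real_imaginary_disjoint iota a0.
have := @singular_line_pair F L iota char2 cardL a; have := @polar0_nval F a.
move: (real_line_pair a) (imaginary_line_pair iota a) => r i.
case: (polar0 a) => [/(_ isT)->|_]; rewrite ?eqxx.
  by case: r i => [] [] //= _ _; [move=> _ /(_ isT).. | move=> /(_ isT)].
case: eqP => [n0 /(_ isT n0)|_ _].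
  by case: r i => [] [] //= _ /(_ isT).
by case: r i => [] [] //=; [move=> _ _ /(_ isT).. | move=> _ /(_ isT)].
Qed.

End Total.

Lemma point_nucleus (F : finFieldType) (P : {vspace 'rV[F]_6}) : is_point P ->
  (P \subset nucleus_plane F) = (diagc (vpick P) == 0).
Proof.
move=> /point_vpick[_ PE]; rewrite row3_eq0.
apply/subsetP/idP => [/(_ _ (memv_pick P))|d0 v]; first by rewrite inE.
rewrite PE => /vlineP[k ->]; rewrite inE !coorZ.
by case/and3P: d0 => /eqP-> /eqP-> /eqP->; rewrite mulr0 eqxx.
Qed.

Lemma double_lineZ (F : finFieldType) (k : F) (a : 'rV[F]_6) :
  2%N \in [pchar F] -> k != 0 -> double_line a -> double_line (k *: a).
Proof. by move=> char2 k0; rewrite !double_lineE // polar0Z. Qed.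

Lemma nonsingularZ (F : finFieldType) (k : F) (a : 'rV[F]_6) :
  2%N \in [pchar F] -> k != 0 -> nonsingular a -> nonsingular (k *: a).
Proof.
move=> /pchar2_2 h2 k0; rewrite !nonsingularE // nvalZ => na.
by rewrite mulf_neq0 ?expf_neq0.
Qed.

Lemma real_line_pairZ (F : finFieldType) (k : F) (a : 'rV[F]_6) :
  k != 0 -> real_line_pair a -> real_line_pair (k *: a).
Proof.
move=> k0 /real_line_pairP[b [c [nbc ->]]]; apply/real_line_pairP.
exists (k *: b), c; rewrite lprodZl; split=> //; apply: contra nbc.
apply: proportional_trans; apply: proportional_sym; apply/existsP.
by exists k; rewrite k0 eqxx.
Qed.

Lemma imaginary_line_pairZ (F L : finFieldType) (iota : {rmorphism F -> L})
    (k : F) (a : 'rV[F]_6) :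
  imaginary_line_pair iota a -> imaginary_line_pair iota (k *: a).
Proof.
move=> /imaginary_line_pairP[t [b [nb aE]]]; apply/imaginary_line_pairP.
by exists (k * t), b; split=> //; rewrite map_mxZ aE scalerA rmorphM.
Qed.

(** Moves the counts to [rat], where they become equations that determine the four unknowns. In the
    second one, the first factor [q - 1] counts the forms of a hyperplane and [2 * (q - 1)] the
    ordered factorisations of a form. The value [I] serves both for the diagonals orthogonal to
    [diagc y] and for the [b] orthogonal to [s], as the two vectors vanish together. *)
Lemma OD4_equations (F L : finFieldType) (iota : {rmorphism F -> L})
    (P : {vspace 'rV[F]_6}) (y := vpick P) (q : rat := #|F|%:R)
    (I : rat := if diagc y == 0 then q ^+ 3 else q ^+ 2) :
    ~~ odd #|F| -> #|L| = (#|F| ^ 2)%N -> is_point P ->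
  exists h1 hr hi h3 : rat,
  [/\ [seq n%:R | n <- OD4 iota P] = [:: h1; hr; hi; h3],
      h1 * (q - 1) + 1 = I,
      hr * (q - 1) * (2 * (q - 1)) + (q ^+ 3 - 1) + (I - 1) * (q - 1)
        = (q ^+ 3 - 1) * q ^+ 2
          + (q ^+ (3 - \rank (symmx y)) - 1) * (q ^+ 3 - q ^+ 2),
      (h1 + hr + hi + h3) * (q - 1) + 1 = q ^+ 5
    & h3 * (q - 1) = if diagc y == 0 then (q ^+ 2 - 1) * (q ^+ 3 - q ^+ 2)
        else (q ^+ 3 - q) * (q ^+ 2 - q)
             + (\rank (symmx y) == 3%N)%:R * ((q - 1) * q ^+ 2)].
Proof.
move=> even_F cardL hP; have char2 := even_card_pchar2 even_F.
have [y0 _] := point_vpick hP; rewrite -/y in y0.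
have qgt0 : (0 < #|F|)%N by rewrite ltnW ?finNzRing_gt1.
have [s sE] : exists s, sqrow s = diagc y.
  have [s0 e0] := sqrt_pchar2 (coor (diagc y) 0) char2.
  have [s1 e1] := sqrt_pchar2 (coor (diagc y) 1) char2.
  have [s2 e2] := sqrt_pchar2 (coor (diagc y) 2) char2.
  by exists (row3 s0 s1 s2); apply: coorP3; rewrite coor_map coor_row3.
have s0E : (s == 0) = (diagc y == 0) by rewrite -sE sqrow_eq0.
have nb1 : ((#|F| - 1)%:R : rat) = q - 1 by rewrite natrB.
have nb0 m n : (n <= m)%N -> ((#|F| ^ m - #|F| ^ n)%:R : rat) = q ^+ m - q ^+ n.
  by move=> le_nm; rewrite natrB ?natrX // leq_pexp2l.
have nb3 : ((#|F| ^ 3 - #|F|)%:R : rat) = q ^+ 3 - q by rewrite (nb0 3 1)%N.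
have nb2 : ((#|F| ^ 2 - #|F|)%:R : rat) = q ^+ 2 - q by rewrite (nb0 2 1)%N.
have nbp n : ((#|F| ^ n - 1)%:R : rat) = q ^+ n - 1 by rewrite (nb0 n 0)%N.
have E1 := nb_throughE hP (fun k a => @double_lineZ F k a char2).
have Er := nb_throughE hP (@real_line_pairZ F).
have Ei := nb_throughE hP (fun k a _ => @imaginary_line_pairZ F L iota k a).
have E3 := nb_throughE hP (fun k a => @nonsingularZ F k a char2).
exists (nb_through P (hyperplanes_of (@double_line F)))%:R,
  (nb_through P (hyperplanes_of (@real_line_pair F)))%:R,
  (nb_through P (hyperplanes_of (imaginary_line_pair iota)))%:R,
  (nb_through P (hyperplanes_of (@nonsingular F)))%:R.
rewrite -/y in E1 Er Ei E3; split=> //.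
- rewrite -nb1 -natrM E1 -(natrD _ _ 1) card_double // /I.
  by case: (_ == 0); apply: natrX.
- have := card_pairs_sum char2 sE; rewrite card_pairs -Er card_dot0 s0E card_kermx.
  rewrite /I; case: (diagc y == 0) => /(congr1 (fun n => n%:R : rat));
    by rewrite !natrD !natrM nb1 !nbp (nb0 3 2)%N // -expr2.
- have := card_forms_total iota char2 cardL y0; rewrite -E1 -Er -Ei -E3 -!mulnDl.
  by move/(congr1 (fun n => n%:R : rat)); rewrite natrX !natrD natrM !natrD nb1.
rewrite -nb1 -natrM E3; have [d0|d0] := eqVneq (diagc y) 0.
  by rewrite card_nonsingular_diag0 // natrM nbp (nb0 3 2)%N.
rewrite (card_nonsingular_diag char2 sE) ?s0E // -rank_symmx //.
by rewrite natrD !natrM nb3 nb2 nb1 -expr2.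
Qed.

Theorem theorem3p3 (F L : finFieldType) (iota : {rmorphism F -> L})
    (hF : ~~ odd #|F|) (hL : #|L| = (#|F| ^ 2)%N)
    (P : {vspace 'rV[F]_6}) (hP : is_point P) :
  let q : rat := #|F|%:R in
  let OD : seq rat := [seq n%:R | n <- OD4 iota P] in
  [/\ orbit_P1 P ->
        OD = [:: q + 1;
                 q ^+ 3 + (3 * q ^+ 2 + q) / 2;
                 (q ^+ 2 - q) / 2;
                 q ^+ 4 - q ^+ 2],
      orbit_P2n P ->
        OD = [:: q ^+ 2 + q + 1;
                 (q ^+ 3 + 2 * q ^+ 2 + q) / 2;
                 (q ^+ 3 - q) / 2;
                 q ^+ 4 - q ^+ 2],
      orbit_P2s P ->
        OD = [:: q + 1;
                 (q ^+ 3 + 3 * q ^+ 2 + q) / 2;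
                 (q ^+ 3 + q ^+ 2 - q) / 2;
                 q ^+ 4 - q ^+ 2]
    & orbit_P3 P ->
        OD = [:: q + 1;
                 (q ^+ 3 + 2 * q ^+ 2 + q) / 2;
                 (q ^+ 3 - q) / 2;
                 q ^+ 4]].
Proof.
move=> q OD.
have [h1 [hr [hi [h3 [ODE E1 Er Et E3]]]]] := OD4_equations iota hF hL hP.
rewrite -/q in E1 Er Et E3.
have q1 : q - 1 != 0.
  by rewrite subr_eq0 Num.Theory.pnatr_eq1; case: (#|F|) (finNzRing_gt1 F) => [|[]].
have [y0 _] := point_vpick hP.
have diag_rank := rank_symmx_diag0 (even_card_pchar2 hF) y0.
(* Each equation is solved for its own unknown; the imaginary pairs come last, as the total less the
   other three. *)
have solve1 x v : x * (q - 1) + 1 = v -> x = (v - 1) / (q - 1).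
  by move=> <-; field.
have solver x b c v : x * (q - 1) * (2 * (q - 1)) + b + c = v ->
    x = (v - b - c) / (2 * (q - 1) ^+ 2).
  by move=> <-; field.
have solve3 x v : x * (q - 1) = v -> x = v / (q - 1) by move=> <-; field.
have solvei v : (h1 + hr + hi + h3) * (q - 1) + 1 = v ->
    hi = (v - 1) / (q - 1) - h1 - hr - h3.
  by move=> <-; field.
move/solve1: E1 => E1; move/solver: Er => Er; move/solve3: E3 => E3.
move/solvei: Et => Et; rewrite /OD ODE Et E1 Er E3 {OD ODE Et E1 Er E3}.
rewrite /orbit_P1 /orbit_P2n /orbit_P2s /orbit_P3 hP /point_rank point_nucleus //=.
split=> [/eqP rk|/andP[/eqP rk d0]|/andP[/eqP rk /negPf d0]|/eqP rk].
(* The rank alone excludes a zero diagonal, which selects the branch of the formulas; in rank 2 the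
   nucleus plane decides. *)
- have /negPf-> : diagc (vpick P) != 0 by apply/eqP => /diag_rank; rewrite rk.
  by rewrite rk /=; congr [:: _; _; _; _]; field.
- by rewrite d0 rk /=; congr [:: _; _; _; _]; field.
- by rewrite d0 rk /=; congr [:: _; _; _; _]; field.
have /negPf-> : diagc (vpick P) != 0 by apply/eqP => /diag_rank; rewrite rk.
by rewrite rk /=; congr [:: _; _; _; _]; field.
Qed.
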